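(* Consider the stochastic approximation $w_{t+1}=w_t+\alpha_tH(w_t,Y_{t+1})$ and suppose Assumptions (M), (P), (L), (D) and (LR1) hold. Then there exists a constant $R\ge 0$ such that: if $\nu<1$, then for any $\zeta\in(0,\frac32\nu-1)$, $\lim_{t\to\infty}t^{\zeta}d(w_t,\mathcal B(R))=0$ a.s.; if $\nu=1$, then for any $\zeta\in(0,1)$ and $\nu_1>0$, $\lim_{t\to\infty}\exp\big(\zeta\ln^{1/(1+\nu_1)}t\big)\, d(w_t,\mathcal B(R))=0$ a.s.
   Context: Let $\langle\cdot,\cdot\rangle$ be an inner product on $\mathbb R^d$ with induced norm $\|\cdot\|$; $\mathcal B(r)\doteq\{x\in\mathbb R^d:\|x\|\le r\}$ and $d(w,\mathcal B(r))\doteq\inf_{x\in\mathcal B(r)}\|w-x\|=\max(\|w\|-r,0)$. Let $\mathcal Y$ be a finite set, $H:\mathbb R^d\times\mathcal Y\to\mathbb R^d$, $\{\alpha_t\}$ deterministic positive learning rates, and $w_{t+1}=w_t+\alpha_tH(w_t,Y_{t+1})$ for $t\ge0$, with $\mathcal F_t\doteq\sigma(w_0,Y_1,\dots,Y_t)$. (M) There is a family $\{P_w:w\in\mathbb R^d\}$ of $|\mathcal Y|\times|\mathcal Y|$ stochastic matrices with $\Pr(Y_{t+1}=y'\mid\mathcal F_t)=P_{w_t}(Y_t,y')$, and for every $P$ in the closure of this family, the time-homogeneous Markov chain with transition matrix $P$ is irreducible and aperiodic. Then each $P_w$ has a unique stationary distribution $d_{\mathcal Y,w}$; define $h(w)\doteq\sum_{y\in\mathcal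 Y}d_{\mathcal Y,w}(y)H(w,y)$. (P) There is a constant $C_P$ such that $\|P_{w_1}-P_{w_2}\|\le\frac{C_P}{1+\|w_1\|+\|w_2\|}\|w_1-w_2\|$ for all $w_1,w_2$ (for a fixed matrix norm). (L) There is a constant $L_h$ with $\|H(w_1,y)-H(w_2,y)\|\le L_h\|w_1-w_2\|$ and $\|H(0,y)\|\le L_h$ for all $w_1,w_2,y$. (D) There are deterministic constants $C_1>0$ and $C_2$ with $\langle w,h(w)\rangle\le -C_1\|w\|^2+C_2$ for all $w$. (LR1) $\alpha_t=\frac{C_\alpha}{(t+3)^\nu}$ with $C_\alpha>0$ and $\nu\in(\frac23,1]$. *)

(* Defs.v *)
From HB Require Import structures.
From mathcomp Require Import all_boot all_order all_algebra.
From mathcomp Require Import all_classical all_reals all_analysis.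
Set Implicit Arguments. Unset Strict Implicit. Unset Printing Implicit Defensive.
Import Order.TTheory GRing.Theory Num.Theory.
Import numFieldNormedType.Exports.
Local Open Scope classical_set_scope.
Local Open Scope ring_scope.

Section Defs.
Variable R : realType.

Definition is_inner_product (d : nat) (ip : 'rV[R]_d -> 'rV[R]_d -> R) : Prop :=
  [/\ (forall x y, ip x y = ip y x),
      (forall a x y z, ip (a *: x + y) z = a * ip x z + ip y z)
    & (forall x, x != 0 -> 0 < ip x x)].

Definition ipnorm (d : nat) (ip : 'rV[R]_d -> 'rV[R]_d -> R) (x : 'rV[R]_d) : R :=
  Num.sqrt (ip x x).

Definition dist_ball (d : nat) (ip : 'rV[R]_d -> 'rV[R]_d -> R) (r : R)
  (w : 'rV[R]_d) : R := Num.max (ipnorm ip w - r) 0.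

Variable Y : finType.

Definition stochastic (Q : Y -> Y -> R) : Prop :=
  (forall y y', 0 <= Q y y') /\ (forall y, \sum_(y' : Y) Q y y' = 1).

Fixpoint kpow (Q : Y -> Y -> R) (n : nat) : Y -> Y -> R :=
  match n with
  | O => fun y y' => if y == y' then 1 else 0
  | S m => fun y y' => \sum_(z : Y) kpow Q m y z * Q z y'
  end.

Definition irreducible (Q : Y -> Y -> R) : Prop :=
  forall y y', exists n, 0 < kpow Q n y y'.

Definition aperiodic (Q : Y -> Y -> R) : Prop :=
  forall y (k : nat), (forall n, (0 < n)%N -> 0 < kpow Q n y y -> (k %| n)%N) -> k = 1%N.

Definition in_closure_family (d : nat) (Pk : 'rV[R]_d -> Y -> Y -> R)
  (Q : Y -> Y -> R) : Prop :=
  forall eps : R, 0 < eps -> exists w, forall y y', `|Pk w y y' - Q y y'| < eps.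

Definition stationary (Q : Y -> Y -> R) (mu : Y -> R) : Prop :=
  (forall y, 0 <= mu y) /\ (\sum_(y : Y) mu y = 1) /\
  (forall y', \sum_(y : Y) mu y * Q y y' = mu y').

(* h(w) computed from a stationary distribution mu of P_w *)
Definition hbar (d : nat) (H : 'rV[R]_d -> Y -> 'rV[R]_d) (mu : Y -> R)
  (w : 'rV[R]_d) : 'rV[R]_d := \sum_(y : Y) mu y *: H w y.

End Defs.

(* generating class of F_t = sigma(w_0, Y_0, ..., Y_t) *)
Definition gen_class (d0 : measure_display) (T : measurableType d0) (R : realType)
  (Y : finType) (d : nat) (w0 : T -> 'rV[R]_d) (Yp : nat -> T -> Y) (t : nat)
  : set (set T) :=
  [set A | exists (B : 'I_d -> set R) (ys : nat -> Y),
     (forall i, measurable (B i)) /\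
     A = [set om | (forall i, B i (w0 om ord0 i)) /\
                   (forall k, (k <= t)%N -> Yp k om = ys k)]].

(* Main.v *)
Require Import Defs.
From HB Require Import structures.
From mathcomp Require Import all_boot all_order all_algebra.
From mathcomp Require Import all_classical all_reals all_analysis.
From mathcomp Require Import measurable_realfun zify ring lra.
Set Implicit Arguments.
Unset Strict Implicit.
Unset Printing Implicit Defensive.

Import Order.TTheory GRing.Theory Num.Theory.
Import numFieldNormedType.Exports.
Local Open Scope classical_set_scope.
Local Open Scope ring_scope.

(** The iterates are almost surely bounded by a deterministic radius from some
    time on, so their distance to the ball is eventually zero and every rate
    holds. Cut time into blocks over which the step sizes sum to between [delta]
    and [2 delta]. Within a block the iterate, hence the transition matrix, moves
    little relative to [1 + |w|] (this is where (P) matches the linear growth of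
    [H]), so the weighted occupation measure of the block is an almost invariant
    vector of the frozen matrix, up to a martingale term. That term is orthogonal
    with summable squares, hence tends to zero almost surely along the blocks. As
    the closure of the family of matrices is a compact set of irreducible
    matrices, almost invariant vectors are uniformly close to stationary laws, so
    a block acts like an Euler step of size about [delta] for [h], and (D) makes
    [|w|^2] contract towards a fixed level. *)

(** * Stationary laws of finite chains *)

(** The obstacle is that [H] grows linearly and nothing bounds the moments of [w 0], so a martingale
    built from [H (w t)] need not even be integrable. The noise is therefore tested only on
    indicators of states: these innovations are at most one in absolute value whatever the iterate,
    and [H] enters afterwards, on a single path. Every error of a block is then relative to 1 + |w|,
    a size that the quadratic term of (D) can absorb. The length [delta] stays fixed: errors
    proportional to [delta] do not vanish, they only have to cost at most half of the drift, and the
    constant terms they leave enlarge the radius. Constants are chosen in the order: relative error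
    [kappa], accuracy [e] of the occupation law, defect of invariance [eta] supplied by compactness,
    then [delta], then the noise level [g]. All of them are deterministic, and so are the block
    boundaries and the radius; only the block from which the noise stays below [g] depends on the
    path. *)

Section InvariantVectors.
Variables (R : realType) (Y : finType).
Implicit Types (Q : Y -> Y -> R) (v : Y -> R).

Definition invariant_vec Q v := forall y', \sum_y v y * Q y y' = v y'.

(** The triangle inequality gives |v| <= |v|Q entrywise, and both sides have the same total because
    rows sum to one, so no entry can be strict. *)
Lemma invariant_vec_norm Q v : stochastic Q -> invariant_vec Q v ->
  invariant_vec Q (fun y => `|v y|).
Proof.
move=> [Q0 Q1] vQ.
have le y' : `|v y'| <= \sum_y `|v y| * Q y y'.
  rewrite -{1}(vQ y'); apply: (le_trans (ler_norm_sum _ _ _)).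
  by apply: ler_sum => y _; rewrite normrM (ger0_norm (Q0 _ _)).
have /eqP : \sum_y' (\sum_y `|v y| * Q y y' - `|v y'|) = 0.
  rewrite sumrB exchange_big /= (eq_bigr (fun y => `|v y|)) ?subrr // => y _.
  by rewrite -mulr_sumr Q1 mulr1.
rewrite psumr_eq0 => [/allP h y'|y' _]; last by rewrite subr_ge0.
by apply/eqP; rewrite -subr_eq0; apply: h; rewrite mem_index_enum.
Qed.

Lemma invariant_vec_kpow Q v n : invariant_vec Q v -> invariant_vec (kpow Q n) v.
Proof.
move=> vQ; elim: n => [|n IH] y' /=.
  rewrite (bigD1 y') //= eqxx mulr1 big1 ?addr0 // => y /negPf ->; exact: mulr0.
under eq_bigr do rewrite mulr_sumr.
rewrite exchange_big /= -[RHS]vQ; apply: eq_bigr => z _.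
by rewrite -(IH z) mulr_suml; apply: eq_bigr => y _; rewrite mulrA.
Qed.

Lemma kpow_ge0 Q n y y' : stochastic Q -> 0 <= kpow Q n y y'.
Proof.
move=> [Q0 _]; elim: n y' => [|n IH] y' /=; first by case: ifP.
by apply: sumr_ge0 => z _; apply: mulr_ge0.
Qed.

Lemma irreducible_invariant_vec_gt0 Q v y0 : stochastic Q -> irreducible Q ->
  invariant_vec Q v -> (forall y, 0 <= v y) -> 0 < v y0 -> forall y, 0 < v y.
Proof.
move=> sQ iQ vQ v0 vy0 y; have [n kn] := iQ y0 y.
rewrite -(invariant_vec_kpow n vQ y) (bigD1 y0) //=.
apply: ltr_wpDr; last exact: mulr_gt0.
by apply: sumr_ge0 => z _; rewrite mulr_ge0 // kpow_ge0.
Qed.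

(** The vector |v| + v is invariant and nonnegative, so one positive entry of [v] would make all
    entries positive, against the zero sum. Hence [v] is nonpositive with zero sum. *)
Lemma irreducible_invariant_vec_eq0 Q v : stochastic Q -> irreducible Q ->
  invariant_vec Q v -> \sum_y v y = 0 -> forall y, v y = 0.
Proof.
move=> sQ iQ vQ sv.
have uQ : invariant_vec Q (fun y => `|v y| + v y).
  move=> y'; under eq_bigr do rewrite mulrDl.
  by rewrite big_split /= (invariant_vec_norm sQ vQ) vQ.
have u0 y : 0 <= `|v y| + v y by have := lerNnormlW (lexx `|v y|); lra.
have vle y : v y <= 0.
  apply/negP => /negP; rewrite -ltNge => vy.
  have up := irreducible_invariant_vec_gt0 sQ iQ uQ u0.
  have {}up z : 0 < v z.
    have : 0 < `|v z| + v z by apply: (up y); rewrite (gtr0_norm vy) addr_gt0.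
    by case: (leP (v z) 0) => // /ler0_norm ->; rewrite addNr ltxx.
  suff : 0 < \sum_y v y by rewrite sv ltxx.
  by rewrite (bigD1 y) //= ltr_wpDr // sumr_ge0 // => z _; apply: ltW.
move=> y; have /eqP : \sum_y - v y = 0 by rewrite sumrN sv oppr0.
rewrite psumr_eq0 => [/allP h|z _]; last by rewrite oppr_ge0.
by apply/eqP; rewrite -oppr_eq0; apply: h; rewrite mem_index_enum.
Qed.

(** Q - I kills the constant column, so it is singular and has a nonzero left null vector; its
    entrywise absolute value is still invariant and can be normalised. *)
Lemma stationary_exists Q (y0 : Y) : stochastic Q -> exists mu, stationary Q mu.
Proof.
move=> sQ; have [Q0 Q1] := sQ.
pose A : 'M[R]_#|Y| :=
  \matrix_(i, j) (Q (enum_val i) (enum_val j) - (i == j)%:R).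
have detA : \det A = 0.
  rewrite -det_tr; apply/eqP/det0P; exists (const_mx 1).
    apply/eqP => /rowP /(_ (enum_rank y0)); rewrite !mxE => /eqP.
    by rewrite oner_eq0.
  apply/rowP => i; rewrite !mxE.
  under eq_bigr do rewrite !mxE mul1r.
  rewrite sumrB -(big_enum_val (fun y => Q (enum_val i) y)) (eq_bigl predT) // Q1.
  rewrite (bigD1 i) //= eqxx big1 ?addr0 ?subrr // => j /negPf.
  by rewrite eq_sym => ->.
have /eqP /det0P [x x0 xA] := detA.
pose v y := x ord0 (enum_rank y).
have vQ : invariant_vec Q v.
  move=> y'; have /rowP /(_ (enum_rank y')) := xA; rewrite !mxE.
  under eq_bigr do rewrite !mxE mulrBr enum_rankK.
  rewrite sumrB => /eqP; rewrite subr_eq0 => /eqP.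
  rewrite [X in _ = X -> _](bigD1 (enum_rank y')) //= eqxx mulr1.
  rewrite [X in _ = _ + X]big1 ?addr0 => [E|j /negPf ->]; last exact: mulr0.
  rewrite {2}/v -E {E}.
  rewrite (reindex_onto (@enum_val Y Y) (@enum_rank Y)) /= => [|? _].
    by apply: eq_big => [i|i _]; rewrite /v enum_valK ?eqxx.
  by rewrite enum_rankK.
have nQ := invariant_vec_norm sQ vQ.
have s0 : 0 < \sum_y `|v y|.
  have [i xi] : exists i, x ord0 i != 0 by apply/rV0Pn.
  rewrite (bigD1 (enum_val i)) //= ltr_wpDr ?sumr_ge0 //.
  by rewrite /v enum_valK normr_gt0.
exists (fun y => `|v y| / \sum_y `|v y|); split; first by move=> y; rewrite divr_ge0 // ltW.
split; first by rewrite -mulr_suml divff // gt_eqF.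
by move=> y'; under eq_bigr do rewrite mulrAC; rewrite -mulr_suml nQ.
Qed.

End InvariantVectors.

(** * Compactness: almost invariant laws are close to stationary ones *)

Section UniformStability.
Variable R : realType.

Lemma eq0_of_small (K a : R) : (forall e, 0 < e -> `|a| <= K * e) -> a = 0.
Proof.
move=> h; apply/eqP; apply: contraT => a0.
have p : 0 < `|a| by rewrite normr_gt0.
have K1 : 0 < `|K| + 1 by apply: ltr_wpDl.
have := h (`|a| / (2 * (`|K| + 1))) (divr_gt0 p (mulr_gt0 (ltr0Sn _ _) K1)).
rewrite leNgt => /negP []; rewrite mulrCA gtr_pMr // ltr_pdivrMr ?mulr_gt0 //.
by have := ler_norm K; lra.
Qed.

Lemma bounded_cluster_point (I : finType) (u : nat -> I -> R) :
  (forall n i, `|u n i| <= 1) ->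
  exists x : I -> R, forall e, 0 < e -> forall N, exists n,
    (N <= n)%N /\ forall i, `|u n i - x i| < e.
Proof.
move=> u1; pose V n : 'rV[R]_#|I| := \row_j u n (enum_val j).
have K : compact [set v : 'rV[R]_#|I| | forall i, `[-1, 1]%classic (v ord0 i)].
  apply: (@rV_compact R #|I| (fun=> `[-1, 1]%classic)) => i; exact: segment_compact.
have [|x [_ xV]] := K (V @ \oo) (fmap_proper_filter _ _).
  by exists 0%N => // n _ i /=; rewrite mxE in_itv /= -ler_norml.
exists (fun i => x ord0 (enum_rank i)) => e e0 N.
have [|v [[n Nn <-] vx]] := xV (V @` [set n | (N <= n)%N]) (ball x e) _ (nbhsx_ballx x e e0).
  by exists N => // n Nn; exists n.
exists n; split=> // i; have [_ /(_ ord0 (enum_rank i))] := vx.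
by rewrite /ball /= mxE enum_rankK distrC.
Qed.

Variables (Y : finType).

Definition prob_vec (r : Y -> R) := (forall y, 0 <= r y) /\ \sum_y r y = 1.

Lemma prob_vec_le1 (r : Y -> R) y : prob_vec r -> r y <= 1.
Proof.
move=> [r0 <-]; rewrite (bigD1 y) //= lerDl; exact: sumr_ge0.
Qed.

(* By contradiction: the differences between a bad almost invariant law and a
   stationary law accumulate at a nonzero invariant vector of total mass zero. *)
Lemma near_stationary (W : Type) (Pk : W -> Y -> Y -> R) (y0 : Y) :
  (forall w, stochastic (Pk w)) ->
  (forall Q, (forall e, 0 < e -> exists w, forall y y', `|Pk w y y' - Q y y'| < e) ->
     irreducible Q) ->
  forall eps, 0 < eps -> exists2 eta, 0 < eta & forall w r, prob_vec r ->
    (forall y', `|\sum_y r y * Pk w y y' - r y'| <= eta) ->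
    exists2 mu, stationary (Pk w) mu & forall y, `|r y - mu y| <= eps.
Proof.
move=> sP iP eps eps0; apply: contrapT => hno.
have bad n : exists x : W * (Y -> R) * (Y -> R),
  [/\ prob_vec x.1.2, stationary (Pk x.1.1) x.2,
   (forall y', `|\sum_y x.1.2 y * Pk x.1.1 y y' - x.1.2 y'| <= n.+1%:R^-1) &
   exists y, eps < `|x.1.2 y - x.2 y|].
  apply: contrapT => nobad; apply: hno; exists n.+1%:R^-1; first by rewrite invr_gt0.
  move=> w r pr hr; have [mu smu] := stationary_exists y0 (sP w).
  exists mu => // y; rewrite leNgt; apply/negP => lt.
  by apply: nobad; exists (w, r, mu); split=> //; exists y.
have [x xP] := choice bad.
(* The gap between the two laws and the kernel share one finite index type, so a single cluster
   point yields the limit vector [v] together with its limit kernel [Q]. *)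
pose u n (i : Y + Y * Y) := match i with
  | inl y => (x n).1.2 y - (x n).2 y
  | inr z => Pk (x n).1.1 z.1 z.2 end.
have u1 n i : `|u n i| <= 1.
  have [pr [mu0 [mu1 _]] _ _] := xP n; have pmu : prob_vec (x n).2 by [].
  case: i => [y|[y y']] /=; rewrite ler_norml.
    have := pr.1 y; have := prob_vec_le1 y pr; have := mu0 y.
    by have := prob_vec_le1 y pmu; move=> ? ? ? ?; apply/andP; split; lra.
  have [P0 P1] := sP (x n).1.1.
  have pP : prob_vec (Pk (x n).1.1 y) by split.
  by have := P0 y y'; have := prob_vec_le1 y' pP; move=> ? ?; apply/andP; split; lra.
have [l ul] := bounded_cluster_point u1.
pose v y := l (inl y); pose Q y y' := l (inr (y, y')).
have near e : 0 < e -> exists n, [/\ n.+1%:R^-1 <= e,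
    (forall y, `|u n (inl y) - v y| < e) &
    (forall y y', `|u n (inr (y, y')) - Q y y'| < e)].
  move=> e0; have [n [Nn un]] := ul e e0 (Num.truncn e^-1).
  exists n; split => //; rewrite -[leRHS]invrK lef_pV2 ?posrE ?invr_gt0 //.
  apply: ltW; apply: (lt_le_trans (truncnS_gt _)).
  by rewrite ler_nat ltnS.
(* [Q] is a limit of members of the family and need not be one of them: this is where irreducibility
   on the closure is used. *)
have iQ : irreducible Q.
  by apply: iP => e /near [n [_ _ h]]; exists (x n).1.1.
have Q0 y y' : 0 <= Q y y'.
  rewrite leNgt; apply/negP => Qn.
  have [|n [_ _ /(_ y y')]] := near (- Q y y'); first by rewrite oppr_gt0.
  rewrite /= real_ltr_norml ?num_real // => /andP[_].
  by have := (sP (x n).1.1).1 y y'; lra.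
have sQ : stochastic Q.
  split=> // y; apply/eqP; rewrite -subr_eq0; apply/eqP.
  apply: (@eq0_of_small #|Y|%:R) => e /near [n [_ _ h]].
  rewrite -[X in _ - X]((sP (x n).1.1).2 y) -sumrB mulr_natl -sumr_const.
  apply: (le_trans (ler_norm_sum _ _ _)); apply: ler_sum => y' _.
  by rewrite distrC; apply: ltW; exact: h.
have sv : \sum_y v y = 0.
  apply: (@eq0_of_small #|Y|%:R) => e /near [n [_ h _]].
  have [pr [_ [mu1 _]] _ _] := xP n.
  have -> : \sum_y v y = \sum_y (v y - u n (inl y)).
    by rewrite !sumrB /= pr.2 mu1; lra.
  rewrite mulr_natl -sumr_const.
  apply: (le_trans (ler_norm_sum _ _ _)); apply: ler_sum => y' _.
  by rewrite distrC; apply: ltW; exact: h.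
have vQ : invariant_vec Q v.
  move=> y'; apply/eqP; rewrite -subr_eq0; apply/eqP.
  apply: (@eq0_of_small (#|Y|%:R * 2 + 2)) => e /near [n [ne hv hQ]].
  have [pr [_ [_ mus]] hr _] := xP n.
  (* Stationarity of [(x n).2] removes its contribution. What remains is the cost of replacing [u n]
     by its limits and the invariance defect of [(x n).1.2]. *)
  have -> : \sum_y v y * Q y y' - v y' =
    \sum_y ((v y - u n (inl y)) * Q y y' + u n (inl y) * (Q y y' - u n (inr (y, y'))))
    + ((\sum_y (x n).1.2 y * Pk (x n).1.1 y y' - (x n).1.2 y')
    + (u n (inl y') - v y')).
    rewrite [X in _ = X + _](eq_bigr (fun y => v y * Q y y' - (x n).1.2 y * Pk (x n).1.1 y y'
        + (x n).2 y * Pk (x n).1.1 y y')) => [|y _]; last by rewrite /u /=; ring.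
    by rewrite big_split sumrB /u /= mus; ring.
  have Q1 y : Q y y' <= 1 by apply: (@prob_vec_le1 (Q y)); split; [exact: Q0 | exact: sQ.2].
  apply: (le_trans (ler_normD _ _)); rewrite mulrDl; apply: lerD; last first.
    apply: (le_trans (ler_normD _ _)); rewrite mulr_natl mulr2n lerD //.
      exact: le_trans (hr y') ne.
    exact: ltW.
  have -> : #|Y|%:R * 2 * e = \sum_(y : Y) (2 * e) by rewrite sumr_const -[RHS]mulr_natl mulrA.
  apply: (le_trans (ler_norm_sum _ _ _)); apply: ler_sum => y _.
  apply: (le_trans (ler_normD _ _)); rewrite mulr_natl mulr2n !normrM lerD //.
    by rewrite -[leRHS]mulr1 ler_pM ?(ger0_norm (Q0 _ _)) // distrC; exact: ltW.
  by rewrite -[leRHS]mul1r ler_pM // distrC; exact: ltW.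
have v0 := irreducible_invariant_vec_eq0 sQ iQ vQ sv.
have [n [_ h _]] := near _ eps0; have [_ _ _ [y]] := xP n.
by have := h y; rewrite v0 subr0 /= => /ltW; rewrite leNgt => /negP.
Qed.
End UniformStability.

(** * Geometry of the inner product norm *)

Section InnerProduct.
Variables (R : realType) (d : nat) (ip : 'rV[R]_d -> 'rV[R]_d -> R).
Hypothesis ipP : is_inner_product ip.
Local Notation N := (ipnorm ip).

Lemma ipC x y : ip x y = ip y x. Proof. by case: ipP. Qed.

Lemma ipDl x y z : ip (x + y) z = ip x z + ip y z.
Proof. by case: ipP => _ h _; rewrite -[x]scale1r h mul1r scale1r. Qed.

Lemma ip0l z : ip 0 z = 0.
Proof. by have /eqP := ipDl 0 0 z; rewrite addr0 -subr_eq0 opprD addNKr oppr_eq0 => /eqP. Qed.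

Lemma ipZl a x z : ip (a *: x) z = a * ip x z.
Proof. by case: ipP => _ h _; rewrite -[a *: x]addr0 h ip0l addr0. Qed.

Lemma ipDr x y z : ip z (x + y) = ip z x + ip z y.
Proof. by rewrite ipC ipDl !(ipC z). Qed.

Lemma ipZr a x z : ip z (a *: x) = a * ip z x.
Proof. by rewrite ipC ipZl (ipC z). Qed.

Lemma ip_ge0 x : 0 <= ip x x.
Proof.
have [->|x0] := eqVneq x 0; first by rewrite ip0l.
by case: ipP => _ _ h; apply/ltW/h.
Qed.

Lemma ipnorm_ge0 x : 0 <= N x. Proof. exact: sqrtr_ge0. Qed.

Lemma ipnorm_sqr x : N x ^+ 2 = ip x x.
Proof. by rewrite sqr_sqrtr // ip_ge0. Qed.

Lemma ip_cauchy_schwarz x y : ip x y <= N x * N y.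
Proof.
have [->|y0] := eqVneq y 0.
  by rewrite ipC ip0l mulr_ge0 // ipnorm_ge0.
have yy : 0 < ip y y by case: ipP => _ _; apply.
have : 0 <= ip y y * (ip x x * ip y y - ip x y ^+ 2).
  have := ip_ge0 (ip y y *: x + (- ip x y) *: y).
  rewrite !(ipDl, ipDr, ipZl, ipZr) (ipC y x).
  by congr (0 <= _); ring.
rewrite pmulr_rge0 // subr_ge0 -!ipnorm_sqr -exprMn => h.
have [xy|xy] := ltP (ip x y) 0.
  by apply: le_trans (ltW xy) _; rewrite mulr_ge0 // ipnorm_ge0.
by rewrite -ler_sqr ?nnegrE // mulr_ge0 // ipnorm_ge0.
Qed.

Lemma ipnormZ a x : N (a *: x) = `|a| * N x.
Proof. by rewrite /ipnorm ipZl ipZr mulrA -expr2 sqrtrM ?sqr_ge0 // sqrtr_sqr. Qed.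

Lemma ipnorm0 : N 0 = 0. Proof. by rewrite /ipnorm ip0l sqrtr0. Qed.

Lemma ipnormN x : N (- x) = N x.
Proof. by rewrite -scaleN1r ipnormZ normrN1 mul1r. Qed.

Lemma ipnormB x y : N (x - y) = N (y - x).
Proof. by rewrite -opprB ipnormN. Qed.

Lemma ipnorm_sqrD x y : N (x + y) ^+ 2 = N x ^+ 2 + 2 * ip x y + N y ^+ 2.
Proof. by rewrite !ipnorm_sqr !(ipDl, ipDr) (ipC y x); ring. Qed.

Lemma ipnorm_triangle x y : N (x + y) <= N x + N y.
Proof.
rewrite -ler_sqr ?nnegrE ?addr_ge0 ?ipnorm_ge0 //.
by rewrite ipnorm_sqrD; have := ip_cauchy_schwarz x y; lra.
Qed.

Lemma ipnorm_sum (I : Type) (r : seq I) (F : I -> 'rV[R]_d) :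
  N (\sum_(i <- r) F i) <= \sum_(i <- r) N (F i).
Proof.
elim/big_rec2: _ => [|i y x _ h]; first by rewrite ipnorm0.
by apply: (le_trans (ipnorm_triangle _ _)); rewrite lerD2l.
Qed.

Lemma ipnorm_le_coord : exists2 K, 0 <= K & forall x, N x <= K * \sum_i `|x ord0 i|.
Proof.
exists (\sum_i N (delta_mx ord0 i)) => [|x]; first by apply: sumr_ge0 => i _; exact: ipnorm_ge0.
rewrite {1}(row_sum_delta x) mulr_sumr; apply: (le_trans (ipnorm_sum _ _)).
apply: ler_sum => i _; rewrite ipnormZ mulrC ler_wpM2r //.
by rewrite (bigD1 i) //= lerDl sumr_ge0 // => j _; exact: ipnorm_ge0.
Qed.

End InnerProduct.

(* Summation by parts: it compares the occupation measures of [y t] and [y t.+1]. *)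
Lemma abel_bound (R : realType) (a b : nat -> R) n m :
  (forall t, 0 <= a t) -> (forall t, a t.+1 <= a t) ->
  (forall t, 0 <= b t <= 1) -> (n <= m)%N ->
  `|\sum_(n <= t < m) a t * (b t.+1 - b t)| <= a n.
Proof.
move=> a0 adec b01 nm.
(* Strengthened for the induction: the slacks [a m * b m] and [a m * (1 - b m)] absorb the next term
   as [a] decreases. *)
suff /andP[l u] : - a n + a m * b m <= \sum_(n <= t < m) a t * (b t.+1 - b t)
    <= a n - a m * (1 - b m).
  have /andP[bl bu] := b01 m; rewrite ler_norml; apply/andP; split.
    by apply: le_trans l; rewrite lerDl mulr_ge0.
  by apply: (le_trans u); rewrite gerBl mulr_ge0 // subr_ge0.
elim: m nm => [|m IH].
  rewrite leqn0 => /eqP ->; have /andP[? ?] := b01 0%N; have ? := a0 0%N.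
  by rewrite (big_geq (leqnn 0)); apply/andP; split; nra.
rewrite leq_eqVlt => /orP[/eqP <-|/ltnSE nm].
  have /andP[? ?] := b01 n; have ? := a0 n.
  by rewrite (big_geq (leqnn n)); apply/andP; split; nra.
rewrite big_nat_recr //=; have /andP[l u] := IH nm.
have /andP[? ?] := b01 m; have /andP[? ?] := b01 m.+1.
have d := adec m; have ? := a0 m; have ? := a0 m.+1.
by apply/andP; split; nra.
Qed.

(** * Drift of the squared norm over one block *)

Section BlockDrift.
Variables (R : realType) (d : nat) (ip : 'rV[R]_d -> 'rV[R]_d -> R) (Y : finType).
Variables (H : 'rV[R]_d -> Y -> 'rV[R]_d) (Pk : 'rV[R]_d -> Y -> Y -> R).
Variables (CP L : R).
Hypothesis ipP : is_inner_product ip.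
Local Notation N := (ipnorm ip).
Hypothesis CP0 : 0 <= CP.
Hypothesis L0 : 0 < L.
Hypothesis PkP : forall w, stochastic (Pk w).
Hypothesis PkL : forall w1 w2 y y',
  `|Pk w1 y y' - Pk w2 y y'| <= CP / (1 + N w1 + N w2) * N (w1 - w2).
Hypothesis HL : forall w1 w2 y, N (H w1 y - H w2 y) <= L * N (w1 - w2).
Hypothesis HB : forall w y, N (H w y) <= L * (1 + N w).

Variables (a : nat -> R) (w : nat -> 'rV[R]_d) (y : nat -> Y).
Hypothesis a0 : forall t, 0 <= a t.
Hypothesis adec : forall t, a t.+1 <= a t.
Hypothesis wS : forall t, w t.+1 = w t + a t *: H (w t) (y t.+1).

Variables (delta : R) (n m : nat).
Local Notation S := (\sum_(n <= t < m) a t).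
Local Notation X := (1 + N (w n)).
Hypothesis nm : (n <= m)%N.
Hypothesis delta0 : 0 < delta.
Hypothesis Ldelta : 4 * L * delta <= 1.
Hypothesis Sl : delta <= S.
Hypothesis Su : S <= 2 * delta.

Let X1 : 1 <= X. Proof. by rewrite lerDl ipnorm_ge0. Qed.

(** A discrete Gronwall argument: [4 * L * delta <= 1] keeps the claimed bound below [X], hence 1 +
    |w t| <= 2X, and the next step adds at most [2 * L * a t * X]. *)
Lemma block_increment t : (n <= t <= m)%N ->
  N (w t - w n) <= 2 * L * (\sum_(n <= s < t) a s) * X.
Proof.
elim: t => [|t IH] /andP[nt tm].
  by move: nt; rewrite leqn0 => /eqP ->; rewrite big_geq // subrr ipnorm0 // mulr0 mul0r.
move: nt; rewrite leq_eqVlt => /orP[/eqP <-|/ltnSE nt].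
  by rewrite big_geq // subrr ipnorm0 // mulr0 mul0r.
have {}IH := IH (introT andP (conj nt (ltnW tm))).
have A0 : 0 <= \sum_(n <= s < t) a s by rewrite sumr_ge0.
have AS : \sum_(n <= s < t) a s <= 2 * delta.
  apply: le_trans Su; rewrite (big_cat_nat (n := t) (p := m) nt (ltnW tm)) /= lerDl.
  by rewrite sumr_ge0.
rewrite big_nat_recr //= wS addrAC.
apply: (le_trans (ipnorm_triangle ipP _ _)).
rewrite ipnormZ // (ger0_norm (a0 t)).
have wt : N (w t) <= N (w n) + N (w t - w n).
  by rewrite -{1}(subrK (w n) (w t)) addrC; exact: ipnorm_triangle.
have Ht := HB (w t) (y t.+1).
have h1 : 2 * L * (\sum_(n <= s < t) a s) * X <= X.
  rewrite ler_piMl ?(le_trans ler01 X1) //.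
  have := ler_wpM2l (ltW L0) AS; move: Ldelta; lra.
have h2 : N (H (w t) (y t.+1)) <= L * (2 * X).
  by apply: (le_trans Ht); rewrite ler_pM2l //; lra.
have h3 := ler_wpM2l (a0 t) h2.
by move: IH h3; lra.
Qed.

Lemma block_increment_le t : (n <= t <= m)%N -> N (w t - w n) <= 4 * L * delta * X.
Proof.
move=> ntm; apply: (le_trans (block_increment ntm)); have /andP[nt tm] := ntm.
rewrite ler_wpM2r //; first by apply: le_trans X1.
have AS : \sum_(n <= s < t) a s <= 2 * delta.
  apply: le_trans Su; rewrite (big_cat_nat (n := t) (p := m) nt tm) /= lerDl.
  by rewrite sumr_ge0.
have := ler_wpM2l (ltW L0) AS; lra.
Qed.

Lemma block_kernel_increment t x x' : (n <= t <= m)%N ->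
  `|Pk (w n) x x' - Pk (w t) x x'| <= 4 * CP * L * delta.
Proof.
move=> /block_increment_le h; apply: (le_trans (PkL _ _ _ _)).
rewrite ipnormB //.
have p := ipnorm_ge0 ip (w t); have q := ipnorm_ge0 ip (w n).
rewrite mulrAC ler_pdivrMr; last by lra.
have : CP * N (w t - w n) <= CP * (4 * L * delta * X) by rewrite ler_wpM2l.
have : 0 <= CP * L * delta * N (w t) by rewrite !mulr_ge0 // ltW.
by lra.
Qed.

(* [occupation 0] weighs the states [y t], [occupation 1] the states [y t.+1]. *)
Definition occupation (i : nat) (z : Y) :=
  (\sum_(n <= t < m) a t * (y (i + t)%N == z)%:R) / S.

Let S0 : 0 < S. Proof. exact: lt_le_trans Sl. Qed.

Lemma sum_eq_indicator (f : Y -> R) z : \sum_x (z == x)%:R * f x = f z.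
Proof.
rewrite (bigD1 z) //= eqxx mul1r big1 ?addr0 // => x.
by rewrite eq_sym => /negPf ->; rewrite mul0r.
Qed.

Lemma occupation_prob_vec i : prob_vec (occupation i).
Proof.
split=> [z|]; first by rewrite divr_ge0 ?sumr_ge0 // => *; rewrite mulr_ge0.
rewrite -mulr_suml exchange_big /= (eq_bigr a) ?divff ?gt_eqF // => t _.
by rewrite -mulr_sumr -[RHS]mulr1; congr (_ * _); rewrite -[RHS](sum_eq_indicator (fun=> 1) (y (i + t)%N)); apply: eq_bigr => x _; rewrite mulr1.
Qed.

Lemma occupation_shift z : `|occupation 1 z - occupation 0 z| <= a n / delta.
Proof.
rewrite /occupation -mulrBl -sumrB normrM normfV (gtr0_norm S0).
rewrite (eq_bigr (fun t => a t * ((y t.+1 == z)%:R - (y t == z)%:R))) => [|t _]; last by rewrite mulrBr.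
apply: ler_pM => //; first by rewrite invr_ge0 ltW.
  apply: abel_bound => // t; first by case: eqP; rewrite lexx ler01.
by rewrite lef_pV2 // posrE.
Qed.

(** Not divided by the block sum, so that it is directly a weighted sum of bounded martingale
    differences with deterministic weights. *)
Definition noise z := \sum_(n <= t < m) a t * ((y t.+1 == z)%:R - Pk (w t) (y t) z).

Lemma occupation_near_invariant g z : `|noise z| <= g ->
  `|\sum_x occupation 0 x * Pk (w n) x z - occupation 0 z|
    <= (g + a n) / delta + 4 * CP * L * delta.
Proof.
move=> hg.
(* Three sources of error: the shift from [y t] to [y t.+1], the martingale part, and the freezing
   of the kernel at [w n]. *)
have E : \sum_x occupation 0 x * Pk (w n) x z - occupation 0 z =
  ((\sum_(n <= t < m) a t * ((y t.+1 == z)%:R - (y t == z)%:R) - noise z)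
   + \sum_(n <= t < m) a t * (Pk (w n) (y t) z - Pk (w t) (y t) z)) / S.
  rewrite /occupation.
  under eq_bigr do rewrite mulrAC mulr_suml.
  rewrite -mulr_suml exchange_big -mulrBl; congr (_ / _).
  rewrite /noise -!sumrB -big_split /=; apply: eq_bigr => t _.
  under eq_bigr do rewrite -mulrA.
  rewrite -mulr_sumr sum_eq_indicator; ring.
have K0 : 0 <= 4 * CP * L * delta by rewrite !mulr_ge0 // ltW.
have h1 : `|\sum_(n <= t < m) a t * ((y t.+1 == z)%:R - (y t == z)%:R)| <= a n.
  by apply: abel_bound => // t; case: eqP; rewrite lexx ler01.
have h2 : `|\sum_(n <= t < m) a t * (Pk (w n) (y t) z - Pk (w t) (y t) z)|
    <= S * (4 * CP * L * delta).
  apply: (le_trans (ler_norm_sum _ _ _)); rewrite mulr_suml.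
  apply: ler_sum_nat => t /andP[nt tm]; rewrite normrM (ger0_norm (a0 t)).
  by rewrite ler_wpM2l // block_kernel_increment // nt ltnW.
rewrite E normrM normfV (gtr0_norm S0) ler_pdivrMr // mulrDl.
apply: (le_trans (ler_normD _ _)); rewrite (mulrC (4 * _ * _ * _)) lerD //.
apply: (le_trans (ler_normB _ _)); rewrite -[leLHS]mulr1.
have g0 : 0 <= g + a n by rewrite addr_ge0 // (le_trans _ hg).
rewrite -mulrA ler_pM ?addr_ge0 //; first by rewrite addrC lerD.
by rewrite mulrC ler_pdivlMr // mul1r.
Qed.

(** Step [t] reads [y t.+1], so freezing the iterate at [w n] leaves [S] times the average of
    [H (w n)] under [occupation 1]. The first error is the freezing, bounded through (L); the second
    is the distance of that law to [mu]. *)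
Lemma block_displacement (mu : Y -> R) e :
  0 <= e -> (forall z, `|occupation 1 z - mu z| <= e) ->
  N (w m - w n - S *: hbar H mu (w n)) <= S * X * (4 * L ^+ 2 * delta + #|Y|%:R * e * L).
Proof.
move=> e0 he.
have wE k : (n <= k)%N -> w k - w n = \sum_(n <= t < k) a t *: H (w t) (y t.+1).
  elim: k => [|k IH]; first by rewrite leqn0 => /eqP ->; rewrite big_geq // subrr.
  rewrite leq_eqVlt => /orP[/eqP <-|/ltnSE nk].
    by rewrite big_geq // subrr.
  by rewrite big_nat_recr //= -IH // wS addrAC.
have E : w m - w n - S *: hbar H mu (w n) =
   \sum_(n <= t < m) a t *: (H (w t) (y t.+1) - H (w n) (y t.+1))
   + S *: \sum_z (occupation 1 z - mu z) *: H (w n) z.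
  rewrite wE // /hbar.
  under [in RHS]eq_bigr do rewrite scalerBr.
  under [X in _ = _ + S *: X]eq_bigr do rewrite scalerBl.
  rewrite !sumrB scalerBr addrA; congr (_ - _); rewrite -addrA.
  rewrite -[LHS]addr0; congr (_ + _); apply/esym/eqP; rewrite addrC subr_eq0; apply/eqP.
  rewrite scaler_sumr.
  under eq_bigr do rewrite scalerA /occupation mulrC divfK ?gt_eqF // scaler_suml.
  rewrite exchange_big; apply: eq_bigr => t _ /=.
  rewrite (bigD1 (y t.+1)) //= eqxx mulr1 big1 ?addr0 // => x.
  by rewrite eq_sym => /negPf ->; rewrite mulr0 scale0r.
rewrite E; apply: (le_trans (ipnorm_triangle ipP _ _)).
rewrite mulrDr; apply: lerD.
  apply: (le_trans (ipnorm_sum ipP _ _)); rewrite -mulrA mulr_suml.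
  apply: ler_sum_nat => t /andP[nt tm]; rewrite ipnormZ // (ger0_norm (a0 t)).
  rewrite ler_wpM2l //; apply: (le_trans (HL _ _ _)).
  have -> : X * (4 * L ^+ 2 * delta) = L * (4 * L * delta * X) by ring.
  by rewrite ler_pM2l // block_increment_le // nt ltnW.
rewrite ipnormZ // (gtr0_norm S0) -mulrA ler_pM2l //.
apply: (le_trans (ipnorm_sum ipP _ _)).
have -> : X * (#|Y|%:R * e * L) = \sum_(z : Y) e * (L * X).
  by rewrite sumr_const -[RHS]mulr_natl; ring.
apply: ler_sum => z _; rewrite ipnormZ // ler_pM // ipnorm_ge0 //.
Qed.

Lemma block_drift (C1 C2 kappa : R) (mu : Y -> R) e :
  0 <= e -> (forall z, `|occupation 1 z - mu z| <= e) -> prob_vec mu ->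
  ip (w n) (hbar H mu (w n)) <= - C1 * N (w n) ^+ 2 + C2 ->
  4 * L ^+ 2 * delta + #|Y|%:R * e * L <= kappa ->
  4 * kappa + 4 * delta * (L + kappa) ^+ 2 <= C1 ->
  N (w m) ^+ 2 <= N (w n) ^+ 2 - S * (C1 * N (w n) ^+ 2 - (2 * `|C2| + C1)).
Proof.
move=> e0 he pmu D hk hC.
set h := hbar H mu (w n) in D *.
pose E := w m - w n - S *: h.
have hE : N E <= S * X * kappa.
  apply: (le_trans (block_displacement e0 he)); rewrite ler_wpM2l // mulr_ge0 ?ltW //.
  exact: lt_le_trans X1.
have hh : N h <= L * X.
  apply: (le_trans (ipnorm_sum ipP _ _)).
  have -> : L * X = \sum_z mu z * (L * X) by rewrite -mulr_suml pmu.2 mul1r.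
  by apply: ler_sum => z _; rewrite ipnormZ // (ger0_norm (pmu.1 z)) ler_wpM2l // pmu.1.
have k0 : 0 <= kappa.
  by apply: le_trans hk; rewrite addr_ge0 ?mulr_ge0 ?exprn_ge0 // ltW.
have hD : N (S *: h + E) <= S * X * (L + kappa).
  apply: (le_trans (ipnorm_triangle ipP _ _)).
  rewrite ipnormZ // (gtr0_norm S0) mulrDr lerD // -mulrA ler_pM2l // (mulrC X) //.
have -> : w m = w n + (S *: h + E) by rewrite /E (addrC (S *: h)) subrK addrC subrK.
set V := S *: h + E in hD *.
rewrite ipnorm_sqrD //.
have hV : N V ^+ 2 <= S * (2 * delta * (X ^+ 2 * (L + kappa) ^+ 2)).
  apply: (@le_trans _ _ ((S * X * (L + kappa)) ^+ 2)).
    by rewrite ler_sqr ?nnegrE ?ipnorm_ge0 // (le_trans _ hD) // ipnorm_ge0.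
  have -> : (S * X * (L + kappa)) ^+ 2 = S * (S * (X ^+ 2 * (L + kappa) ^+ 2)) by ring.
  rewrite ler_pM2l // ler_wpM2r //.
  by rewrite mulr_ge0 ?sqr_ge0.
have hip : ip (w n) V <= S * (- C1 * N (w n) ^+ 2 + C2) + S * (X ^+ 2 * kappa).
  rewrite /V (ipDr ipP) (ipZr ipP) lerD ?ler_pM2l //.
  apply: (le_trans (ip_cauchy_schwarz ipP _ _)).
  have -> : S * (X ^+ 2 * kappa) = X * (S * X * kappa) by ring.
  by rewrite ler_pM ?ipnorm_ge0 // lerDr.
have hX : X ^+ 2 <= 2 * (1 + N (w n) ^+ 2).
  by have := sqr_ge0 (1 - N (w n)); lra.
have c2 := ler_norm C2.
have hL := sqr_ge0 (L + kappa).
have e1 := ler_wpM2r k0 hX.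
have e2 := ler_wpM2l (ltW delta0) (ler_wpM2r hL hX).
have e3 : (4 * kappa + 4 * delta * (L + kappa) ^+ 2) * (1 + N (w n) ^+ 2)
    <= C1 * (1 + N (w n) ^+ 2).
  by rewrite ler_wpM2r // addr_ge0 ?sqr_ge0.
rewrite -addrA lerD2l -mulrN.
apply: (@le_trans _ _ (S * (2 * (- C1 * N (w n) ^+ 2 + C2) + 2 * (X ^+ 2 * kappa)
   + 2 * delta * (X ^+ 2 * (L + kappa) ^+ 2)))).
  by lra.
rewrite ler_pM2l //; lra.
Qed.
End BlockDrift.

(** * Choice of the constants and descent over one block *)

Section Descent.
Variables (R : realType) (d : nat) (ip : 'rV[R]_d -> 'rV[R]_d -> R) (Y : finType).
Variables (H : 'rV[R]_d -> Y -> 'rV[R]_d) (Pk : 'rV[R]_d -> Y -> Y -> R).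
Variables (CP L C1 C2 : R) (y0 : Y).
Hypothesis ipP : is_inner_product ip.
Local Notation N := (ipnorm ip).
Hypothesis CP0 : 0 <= CP.
Hypothesis L0 : 0 < L.
Hypothesis C10 : 0 < C1.
Hypothesis PkP : forall w, stochastic (Pk w).
Hypothesis PkI : forall Q, in_closure_family Pk Q -> irreducible Q.
Hypothesis PkL : forall w1 w2 y y',
  `|Pk w1 y y' - Pk w2 y y'| <= CP / (1 + N w1 + N w2) * N (w1 - w2).
Hypothesis HL : forall w1 w2 y, N (H w1 y - H w2 y) <= L * N (w1 - w2).
Hypothesis HB : forall w y, N (H w y) <= L * (1 + N w).
Hypothesis HD : forall w mu, stationary (Pk w) mu ->
  ip w (hbar H mu w) <= - C1 * N w ^+ 2 + C2.

(** [delta] and [g] come before the path and the block, hence are uniform. [2 * delta * C1 <= 1]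
    keeps the contraction factor of a block nonnegative, and the last conclusion controls times
    inside a block. *)
Lemma block_descent : exists delta g : R, [/\ 0 < delta, 0 < g, 2 * delta * C1 <= 1 &
  forall (a : nat -> R) w y n m,
    (forall t, 0 <= a t) -> (forall t, a t.+1 <= a t) ->
    (forall t, w t.+1 = w t + a t *: H (w t) (y t.+1)) -> (n <= m)%N ->
    delta <= \sum_(n <= t < m) a t <= 2 * delta -> a n <= g ->
    (forall z, `|noise Pk a w y n m z| <= g) ->
    N (w m) ^+ 2 <= N (w n) ^+ 2
       - (\sum_(n <= t < m) a t) * (C1 * N (w n) ^+ 2 - (2 * `|C2| + C1)) /\
    forall t, (n <= t <= m)%N -> N (w t) <= 2 * N (w n) + 1].
Proof.
(* With this [kappa] the term [4 * kappa] takes half of [C1]; [e] is such that the law error takes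
   at most half of [kappa]. *)
pose kappa := C1 / 8; have k0 : 0 < kappa by rewrite divr_gt0.
pose cY : R := #|Y|%:R + 1; have cY0 : 0 < cY by rewrite ltr_wpDl.
pose e := kappa / (2 * cY * L); have e0 : 0 < e by rewrite divr_gt0 ?mulr_gt0.
have e20 : 0 < e / 2 by rewrite divr_gt0.
have [eta eta0 st] := near_stationary y0 PkP PkI e20.
(* Each smallness condition on [delta] reads delta * q <= 1; the inverse of the sum [K] of all these
   q meets them together. *)
have [q1 q1E] : exists q, q = 8 * L ^+ 2 / kappa by eexists.
have [q2 q2E] : exists q, q = 8 * (L + kappa) ^+ 2 / C1 by eexists.
have [q3 q3E] : exists q, q = 8 * CP * L / eta by eexists.
pose K := 4 * L + q1 + q2 + q3 + 2 * C1.
have p1 : 0 <= q1 by rewrite q1E; apply: divr_ge0; [apply: mulr_ge0 => //; exact: sqr_ge0 | exact: ltW].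
have p2 : 0 <= q2 by rewrite q2E; apply: divr_ge0; [apply: mulr_ge0 => //; exact: sqr_ge0 | exact: ltW].
have p3 : 0 <= q3 by rewrite q3E; apply: divr_ge0; [rewrite !mulr_ge0 // ltW | exact: ltW].
have K0 : 0 < K by rewrite /K; move: p1 p2 p3 L0 C10; lra.
pose delta := K^-1; have dl0 : 0 < delta by rewrite invr_gt0.
have small x : 0 <= x -> x <= K -> delta * x <= 1.
  by move=> x0 xK; rewrite /delta mulrC ler_pdivrMr // mul1r.
pose g := delta * Num.min (eta / 4) (e / 2).
have gle : g <= delta * (eta / 4) /\ g <= delta * (e / 2).
  by rewrite /g; split; rewrite ler_pM2l // ge_min lexx ?orbT.
have g0 : 0 < g by rewrite mulr_gt0 // lt_min e20 divr_gt0.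
have d1 : 4 * L * delta <= 1 by rewrite mulrC; apply: small; rewrite /K; move: p1 p2 p3 L0 C10; lra.
have d2 : 8 * L ^+ 2 * delta <= kappa.
  have : delta * q1 <= 1 by apply: small => //; rewrite /K; move: p1 p2 p3 L0 C10; lra.
  by rewrite q1E mulrA ler_pdivrMr // mul1r (mulrC delta).
have d3 : 8 * (L + kappa) ^+ 2 * delta <= C1.
  have : delta * q2 <= 1 by apply: small => //; rewrite /K; move: p1 p2 p3 L0 C10; lra.
  by rewrite q2E mulrA ler_pdivrMr // mul1r (mulrC delta).
have d4 : 8 * CP * L * delta <= eta.
  have : delta * q3 <= 1 by apply: small => //; rewrite /K; move: p1 p2 p3 L0 C10; lra.
  by rewrite q3E mulrA ler_pdivrMr // mul1r (mulrC delta).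
have d5 : 2 * delta * C1 <= 1.
  by rewrite mulrAC mulrC; apply: small; rewrite /K; move: p1 p2 p3 L0 C10; lra.
exists delta, g; split=> // a w y n m a0 adec wS nm /andP[Sl Su] an hn.
have S0 : 0 < \sum_(n <= t < m) a t by apply: lt_le_trans Sl.
split; last first.
  move=> t ntm; have h := block_increment_le ipP L0 HB a0 wS d1 Su ntm.
  have : N (w t) <= N (w n) + N (w t - w n).
    by rewrite -{1}(subrK (w n) (w t)) addrC; exact: ipnorm_triangle.
  have : 4 * L * delta * (1 + N (w n)) <= 1 * (1 + N (w n)).
    by rewrite ler_wpM2r // addr_ge0 // ipnorm_ge0.
  by move: h; lra.
have [gl1 gl2] := gle.
have pv i := occupation_prob_vec y a0 dl0 Sl i.
have [z|mu smu hmu] := st (w n) _ (pv 0%N).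
  apply: (le_trans (occupation_near_invariant ipP CP0 L0 PkL HB a0 adec wS nm dl0 d1 Sl Su (hn z))).
  have : (g + a n) / delta <= eta / 2.
    by rewrite ler_pdivrMr //; lra.
  by lra.
apply: (block_drift ipP L0 HL HB a0 wS nm dl0 d1 Sl Su (kappa := kappa) (mu := mu) (e := e)).
- exact: ltW.
(* Compactness places [occupation 0] within [e / 2] of [mu]; the shift to [occupation 1] costs the
   other [e / 2]. *)
- move=> z; rewrite (le_trans (ler_distD (occupation a y n m 0 z) _ _)) //.
  rewrite [leRHS]splitr lerD // (le_trans (occupation_shift y a0 adec nm dl0 Sl z)) //.
  by rewrite ler_pdivrMr //; lra.
- by split; [exact: smu.1|exact: smu.2.1].
- exact: HD.
- have : #|Y|%:R * e * L <= kappa / 2.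
    have -> : kappa / 2 = cY * e * L.
      by rewrite /e; field; rewrite !gt_eqF.
    by rewrite !ler_pM2r // /cY lerDl.
  by lra.
- by rewrite /kappa; move: d3; rewrite /kappa; lra.
Qed.

End Descent.

(** * From single blocks to the whole path *)

(** The excess over the fixed point [B / C] is multiplied by [1 - S k * C], which lies in [0, 1).
    Once at most 1 it stays so; while above 1 it loses at least [delta * C] per step, which cannot
    last. *)
Lemma relaxation_eventually_le (R : realType) (x S : nat -> R) (C B delta : R) k0 :
  0 < C -> 0 < delta -> (forall k, (k0 <= k)%N -> delta <= S k) ->
  (forall k, (k0 <= k)%N -> S k * C <= 1) ->
  (forall k, (k0 <= k)%N -> x k.+1 <= x k - S k * (C * x k - B)) ->
  exists k1, forall k, (k1 <= k)%N -> x k <= B / C + 1.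
Proof.
move=> C0 dl0 Sl Su xS.
pose b k := x k - B / C.
have bS k : (k0 <= k)%N -> b k.+1 <= (1 - S k * C) * b k.
  move=> kk; have := xS k kk.
  have -> : S k * (C * x k - B) = S k * C * b k.
    by rewrite /b; field; rewrite gt_eqF.
  by rewrite /b; lra.
suff [k1 [k01 bk1]] : exists k1, (k0 <= k1)%N /\ b k1 <= 1.
  exists k1 => k; rewrite -lerBlDl -/(b k) => /subnK <-.
  elim: (k - k1)%N => [//|i IH]; rewrite addSn.
  have kk : (k0 <= i + k1)%N by rewrite (leq_trans k01) // leq_addl.
  have h1 := Su _ kk; have h2 := Sl _ kk; apply: (le_trans (bS _ kk)).
  have h3 : 0 < S (i + k1)%N * C by rewrite mulr_gt0 // (lt_le_trans dl0).
  have : (1 - S (i + k1)%N * C) * b (i + k1)%N <= (1 - S (i + k1)%N * C) * 1.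
    by rewrite ler_wpM2l // subr_ge0.
  by lra.
apply: contrapT => hno.
have bgt k : (k0 <= k)%N -> 1 < b k.
  by move=> kk; rewrite ltNge; apply/negP => le; apply: hno; exists k.
have bdec i : b (i + k0)%N <= b k0 - i%:R * (delta * C).
  elim: i => [|i IH]; first by rewrite add0n mul0r subr0.
  have kk : (k0 <= i + k0)%N by rewrite leq_addl.
  rewrite addSn; apply: (le_trans (bS _ kk)); rewrite -natr1 mulrDl mul1r.
  have h1 : delta * C <= S (i + k0)%N * C * b (i + k0)%N.
    rewrite -[leLHS]mulr1 ler_pM ?ler_pM2r ?Sl //; last exact/ltW/bgt.
    by rewrite mulr_ge0 // ltW.
  by lra.
have dC : 0 < delta * C by rewrite mulr_gt0.
have := bdec (Num.truncn (b k0 / (delta * C))).+1.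
have := truncnS_gt (b k0 / (delta * C)); rewrite ltr_pdivrMr // => h1 h2.
by have := bgt _ (leq_addl (Num.truncn (b k0 / (delta * C))).+1 k0); lra.
Qed.

(** Greedy cutting: a block ends as soon as its sum reaches [delta]. Starting where the steps are
    below [delta], the last term overshoots by at most [delta]. *)
Lemma block_partition (R : realType) (a : nat -> R) (delta g : R) :
  0 < delta -> 0 < g -> (forall t, 0 <= a t) -> (forall t, a t.+1 <= a t) ->
  (forall e, 0 < e -> exists n, a n <= e) ->
  (forall n K, exists m, K <= \sum_(n <= t < m) a t) ->
  exists nb : nat -> nat, forall k, [/\ (nb k < nb k.+1)%N, a (nb k) <= g &
     delta <= \sum_(nb k <= t < nb k.+1) a t <= 2 * delta].
Proof.
move=> dl0 g0 a0 adec asmall adiv.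
have amono n m : (n <= m)%N -> a m <= a n.
  move=> /subnK <-; elim: (m - n)%N => [//|i IH].
  by rewrite addSn (le_trans (adec _)).
have [|n0 an0] := asmall (Num.min delta g); first by rewrite lt_min dl0.
have step n : exists m, (n0 <= n)%N ->
    (n < m)%N /\ delta <= \sum_(n <= t < m) a t <= 2 * delta.
  have ex : exists m, delta <= \sum_(n <= t < m) a t by exact: adiv.
  exists (ex_minn ex); case: ex_minnP => m hm mmin n0n.
  have nm : (n < m)%N.
    by rewrite ltnNge; apply/negP => mn; move: hm; rewrite big_geq // leNgt dl0.
  split => //; rewrite hm /=; case: m hm mmin nm => // m hm mmin; rewrite ltnS => nm.
  rewrite big_nat_recr //= mulrDl !mul1r lerD //.
    by rewrite leNgt; apply/negP => /ltW /mmin; rewrite ltnn.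
  by apply: (le_trans (amono _ _ (leq_trans n0n nm))); apply: (le_trans an0); rewrite ge_min lexx.
have [nx nxP] := choice step.
have n0k k : (n0 <= iter k nx n0)%N.
  by elim: k => //= k IH; apply: (leq_trans IH); apply: ltnW; case: (nxP _ IH).
exists (fun k => iter k nx n0) => k; have [lt S] := nxP _ (n0k k).
split=> //; apply: (le_trans (amono _ _ (n0k k))); apply: (le_trans an0).
by rewrite ge_min lexx orbT.
Qed.

Lemma between_blocks (nb : nat -> nat) k0 t : (forall k, (nb k < nb k.+1)%N) ->
  (nb k0 <= t)%N -> exists k, (k0 <= k)%N /\ (nb k <= t < nb k.+1)%N.
Proof.
move=> nbS k0t.
have nbge k : (k <= nb k)%N by elim: k => // k IH; apply: leq_ltn_trans (nbS k).
have ex : exists k, (t < nb k)%N by exists t.+1; exact: nbge.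
have nbm : {homo nb : i j / (i <= j)%N} by apply: (homo_leq leqnn leq_trans) => i; exact: ltnW.
case: (ex_minnP ex) => -[|k] tk kmin.
  by move: k0t; rewrite leqNgt (leq_trans tk) // nbm.
exists k; rewrite tk andbT; split; last first.
  by rewrite leqNgt; apply/negP => /kmin; rewrite ltnn.
by rewrite -ltnS ltnNge; apply/negP => /nbm h; move: (leq_trans tk h); rewrite ltnNge k0t.
Qed.

Section PathwiseBound.
Variables (R : realType) (d : nat) (ip : 'rV[R]_d -> 'rV[R]_d -> R) (Y : finType).
Variables (H : 'rV[R]_d -> Y -> 'rV[R]_d) (Pk : 'rV[R]_d -> Y -> Y -> R).
Variables (CP L C1 C2 : R) (y0 : Y).
Hypothesis ipP : is_inner_product ip.
Local Notation N := (ipnorm ip).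
Hypothesis CP0 : 0 <= CP.
Hypothesis L0 : 0 < L.
Hypothesis C10 : 0 < C1.
Hypothesis PkP : forall w, stochastic (Pk w).
Hypothesis PkI : forall Q, in_closure_family Pk Q -> irreducible Q.
Hypothesis PkL : forall w1 w2 y y',
  `|Pk w1 y y' - Pk w2 y y'| <= CP / (1 + N w1 + N w2) * N (w1 - w2).
Hypothesis HL : forall w1 w2 y, N (H w1 y - H w2 y) <= L * N (w1 - w2).
Hypothesis HB : forall w y, N (H w y) <= L * (1 + N w).
Hypothesis HD : forall w mu, stationary (Pk w) mu ->
  ip w (hbar H mu w) <= - C1 * N w ^+ 2 + C2.

(** Purely deterministic, one path at a time. The square root bounds the iterate at block
    boundaries, and the map x -> 2x + 1 extends the bound to the inside of blocks. *)
Lemma eventually_bounded_of_small_noise : exists delta g : R, [/\ 0 < delta, 0 < g &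
  forall (a : nat -> R) nb w y,
    (forall t, 0 <= a t) -> (forall t, a t.+1 <= a t) ->
    (forall k, [/\ (nb k < nb k.+1)%N, a (nb k) <= g &
       delta <= \sum_(nb k <= t < nb k.+1) a t <= 2 * delta]) ->
    (forall t, w t.+1 = w t + a t *: H (w t) (y t.+1)) ->
    (exists k0, forall k, (k0 <= k)%N ->
       forall z, `|noise Pk a w y (nb k) (nb k.+1) z| <= g) ->
    exists t0, forall t, (t0 <= t)%N ->
      N (w t) <= 2 * Num.sqrt ((2 * `|C2| + C1) / C1 + 1) + 1].
Proof.
have [delta [g [dl0 g0 dC desc]]] :=
  block_descent y0 ipP CP0 L0 C10 PkP PkI PkL HL HB HD.
exists delta, g; split=> // a nb w y a0 adec nbP wS [k0 hn].
have step k (kk : (k0 <= k)%N) := let: And3 lt an Sb := nbP k in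
  desc a w y (nb k) (nb k.+1) a0 adec wS (ltnW lt) Sb an (hn k kk).
have [k1 hk1] : exists k1, forall k, (k1 <= k)%N ->
    N (w (nb k)) ^+ 2 <= (2 * `|C2| + C1) / C1 + 1.
  apply: (relaxation_eventually_le (S := fun k => \sum_(nb k <= t < nb k.+1) a t) (k0 := k0) C10 dl0).
  - by move=> k _; have [_ _ /andP[]] := nbP k.
  - move=> k _; have [_ _ /andP[_ Su]] := nbP k.
    by apply: le_trans dC; rewrite ler_pM2r.
  - by move=> k /step [].
exists (nb (maxn k0 k1)) => t /(between_blocks (fun k => let: And3 lt _ _ := nbP k in lt)).
move=> [k [kk /andP[l u]]].
have [_ /(_ t)] := step k (leq_trans (leq_maxl _ _) kk).
rewrite l (ltnW u) => /(_ isT) h; apply: (le_trans h).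
rewrite lerD2r ler_pM2l //.
by rewrite -[N (w (nb k))]ger0_norm ?ipnorm_ge0 // -sqrtr_sqr ler_wsqrtr // hk1 // (leq_trans (leq_maxr _ _) kk).
Qed.
End PathwiseBound.

(** * Block sums of orthogonal random variables *)

Section BoundedIntegrals.
Variables (d0 : measure_display) (T : measurableType d0) (R : realType).
Variable P : probability T R.
Implicit Types f g : T -> R.

Definition bounded_mfun f := measurable_fun setT f /\ exists K, forall x, `|f x| <= K.

Local Notation E f := (Rintegral P setT f).

Lemma bounded_mfun_cst c : bounded_mfun (fun=> c).
Proof. by split; [exact: measurable_cst|exists `|c|]. Qed.

Lemma bounded_mfunD f g : bounded_mfun f -> bounded_mfun g -> bounded_mfun (fun x => f x + g x).
Proof.
move=> [mf [K fK]] [mg [K' gK]]; split; first exact: measurable_funD.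
by exists (K + K') => x; rewrite (le_trans (ler_normD _ _)) // lerD.
Qed.

Lemma bounded_mfunM f g : bounded_mfun f -> bounded_mfun g -> bounded_mfun (fun x => f x * g x).
Proof.
move=> [mf [K fK]] [mg [K' gK]]; split; first exact: measurable_funM.
by exists (K * K') => x; rewrite normrM ler_pM.
Qed.

Lemma bounded_mfunZ c f : bounded_mfun f -> bounded_mfun (fun x => c * f x).
Proof. by move=> bf; apply: bounded_mfunM => //; exact: bounded_mfun_cst. Qed.

Lemma bounded_mfun_sum (I : Type) (s : seq I) (F : I -> T -> R) :
  (forall i, bounded_mfun (F i)) -> bounded_mfun (fun x => \sum_(i <- s) F i x).
Proof.
move=> bF; elim: s => [|i s IH].
  by under eq_fun do rewrite big_nil; exact: bounded_mfun_cst.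
by under eq_fun do rewrite big_cons; exact: bounded_mfunD.
Qed.

Lemma bounded_mfun_integrable f : bounded_mfun f -> P.-integrable setT (EFin \o f).
Proof.
move=> [mf [K fK]]; apply: measurable_bounded_integrable => //.
  by apply: le_lt_trans (probability_le1 P measurableT) (ltry _).
exists K; split; first exact: num_real.
by move=> M KM x _; apply: le_trans (ltW KM).
Qed.

Lemma expectD f g : bounded_mfun f -> bounded_mfun g ->
  E (fun x => f x + g x) = E f + E g.
Proof. by move=> bf bg; apply: RintegralD => //; exact: bounded_mfun_integrable. Qed.

Lemma expectZ c f : bounded_mfun f -> E (fun x => c * f x) = c * E f.
Proof. by move=> bf; apply: RintegralZl => //; exact: bounded_mfun_integrable. Qed.

Lemma expect_sum (I : Type) (s : seq I) (F : I -> T -> R) :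
  (forall i, bounded_mfun (F i)) ->
  E (fun x => \sum_(i <- s) F i x) = \sum_(i <- s) E (F i).
Proof.
move=> bF; elim: s => [|i s IH].
  under [in LHS]eq_fun do rewrite big_nil.
  by rewrite big_nil Rintegral_cst // mul0r.
under [in LHS]eq_fun do rewrite big_cons.
by rewrite big_cons -IH expectD //; exact: bounded_mfun_sum.
Qed.

Lemma expect_le f g : bounded_mfun f -> bounded_mfun g -> (forall x, f x <= g x) ->
  E f <= E g.
Proof. by move=> bf bg fg; apply: le_Rintegral => //; exact: bounded_mfun_integrable. Qed.

Lemma expect_cst c : E (fun=> c) = c.
Proof.
rewrite Rintegral_cst // (_ : fine _ = 1) ?mulr1 //.
by rewrite -[RHS]/(fine 1%E); congr fine; exact: probability_setT.
Qed.

Section OrthogonalSums.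
Variables (X : nat -> T -> R) (a : nat -> R).
Hypothesis mX : forall t, measurable_fun setT (X t).
Hypothesis X1 : forall t x, `|X t x| <= 1.
Hypothesis XX : forall s t, (s < t)%N -> E (fun x => X s x * X t x) = 0.

Let bX t : bounded_mfun (X t). Proof. by split; [exact: mX|exists 1]. Qed.

Lemma bounded_mfun_wsum n m : bounded_mfun (fun x => \sum_(n <= t < m) a t * X t x).
Proof. by apply: bounded_mfun_sum => i; exact: bounded_mfunZ. Qed.

(** Adding the term of index [m] creates a cross term that vanishes by orthogonality and a square of
    mean at most [a m ^+ 2]. *)
Lemma second_moment_wsum n m :
  E (fun x => (\sum_(n <= t < m) a t * X t x) ^+ 2) <= \sum_(n <= t < m) a t ^+ 2.
Proof.
elim: m => [|m IH].
  under eq_fun do rewrite big_geq // expr0n.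
  by rewrite big_geq // expect_cst.
have [nm|mn] := leqP n m; last first.
  under eq_fun do rewrite big_geq // expr0n.
  by rewrite big_geq // expect_cst.
rewrite big_nat_recr //=.
have EE : (fun x => (\sum_(n <= t < m.+1) a t * X t x) ^+ 2) =
  (fun x => (\sum_(n <= t < m) a t * X t x) ^+ 2 +
    ((2 * a m) * \sum_(n <= t < m) a t * (X t x * X m x) + a m ^+ 2 * X m x ^+ 2)).
  apply/funext => x; rewrite big_nat_recr //=.
  have -> : \sum_(n <= t < m) a t * (X t x * X m x) = (\sum_(n <= t < m) a t * X t x) * X m x.
    by rewrite mulr_suml; apply: eq_bigr => t _; rewrite mulrA.
  ring.
have b1 : bounded_mfun (fun x => \sum_(n <= t < m) a t * (X t x * X m x)).
  by apply: bounded_mfun_sum => i; apply: bounded_mfunZ; exact: bounded_mfunM.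
have b2 : bounded_mfun (fun x => X m x ^+ 2).
  by under eq_fun do rewrite expr2; exact: bounded_mfunM.
have b3 : bounded_mfun (fun x => (\sum_(n <= t < m) a t * X t x) ^+ 2).
  by under eq_fun do rewrite expr2; apply: bounded_mfunM; exact: bounded_mfun_wsum.
rewrite EE expectD //; last by apply: bounded_mfunD; exact: bounded_mfunZ.
rewrite lerD // expectD ?expectZ //; try exact: bounded_mfunZ.
rewrite expect_sum; last by move=> i; apply: bounded_mfunZ; exact: bounded_mfunM.
rewrite big_nat big1 ?mulr0 ?add0r => [|t /andP[_ tm]]; last first.
  by rewrite expectZ ?XX ?mulr0 //; exact: bounded_mfunM.
rewrite ler_piMr ?sqr_ge0 // -[leRHS]expect_cst; apply: expect_le => //.
  exact: bounded_mfun_cst.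
by move=> x; rewrite -real_normK ?num_real // exprn_ile1.
Qed.

(** The blocks are disjoint, so the expected squares of their sums add up to at most [K]. The series
    of squares is then finite almost everywhere. Only complete blocks matter, so no maximal
    inequality is involved. *)
Lemma block_sums_small (nb : nat -> nat) (K g : R) :
  (forall k, (nb k < nb k.+1)%N) -> (forall n, \sum_(0 <= t < n) a t ^+ 2 <= K) -> 0 < g ->
  {ae P, forall x, exists k0, forall k, (k0 <= k)%N ->
     `|\sum_(nb k <= t < nb k.+1) a t * X t x| <= g}.
Proof.
move=> nbS aK g0.
pose G k x := (\sum_(nb k <= t < nb k.+1) a t * X t x) ^+ 2.
have bG k : bounded_mfun (G k).
  by rewrite /G; under eq_fun do rewrite expr2; apply: bounded_mfunM; exact: bounded_mfun_wsum.
have mG k : measurable_fun setT (EFin \o G k) by apply/measurable_EFinP; exact: (bG k).1.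
have G0 k x : (0 <= (EFin \o G k) x)%E by rewrite lee_fin sqr_ge0.
have sumE n : \sum_(0 <= k < n) E (G k) <= K.
  apply: le_trans (aK (nb n)).
  have : \sum_(0 <= k < n) E (G k) <= \sum_(nb 0%N <= t < nb n) a t ^+ 2.
    elim: n => [|n IH]; first by rewrite !big_geq.
    have n0n : (nb 0 <= nb n)%N.
      by elim: n {IH} => // n IH; exact: leq_trans IH (ltnW (nbS _)).
    rewrite big_nat_recr //= (big_cat_nat n0n (ltnW (nbS n))) /= lerD //.
    exact: second_moment_wsum.
  move=> h; apply: (le_trans h).
  have n0n : (nb 0 <= nb n)%N.
    by elim: n {h} => // n IH; exact: leq_trans IH (ltnW (nbS _)).
  rewrite [leRHS](big_cat_nat (leq0n _) n0n) /= lerDr.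
  by apply: sumr_ge0 => *; exact: sqr_ge0.
have iE k : (\int[P]_x (EFin \o G k) x)%E = (E (G k))%:E.
  by rewrite fineK // integrable_fin_num //; exact: bounded_mfun_integrable.
have fin : (\int[P]_x (\sum_(k <oo) (EFin \o G k) x) < +oo)%E.
  rewrite integral_nneseries //.
  apply: (@le_lt_trans _ _ K%:E); last exact: ltry.
  apply: lime_le; first by apply: is_cvg_nneseries => k _ _; rewrite iE lee_fin Rintegral_ge0 // => x _; exact: sqr_ge0.
  by apply: nearW => n; rewrite (eq_bigr _ (fun k _ => iE k)) sumEFin lee_fin.
have mS : measurable_fun setT (fun x => \sum_(k <oo) (EFin \o G k) x)%E.
  by apply: ge0_emeasurable_sum.
have iS : P.-integrable setT (fun x => \sum_(k <oo) (EFin \o G k) x)%E.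
  apply/integrableP; split => //.
  by under eq_integral do rewrite gee0_abs ?nneseries_ge0 //.
have := integrable_ae measurableT iS.
apply: filterS => x /(_ I) Sx.
have Soo : (\sum_(0 <= k <oo) (EFin \o G k) x < +oo)%E by rewrite ltey_eq Sx.
(* The tail of a convergent nonnegative series tends to zero and dominates its first term [G k x],
   hence the threshold [g ^+ 2]. *)
have := nneseries_tail_cvg (P := xpredT) Soo (fun k _ => G0 k x).
move=> /fine_cvgP [[k1 _ hk1]] /cvgrPdist_lt /(_ (g ^+ 2)).
rewrite exprn_gt0 // => /(_ isT) [k2 _ hk2].
exists (maxn k1 k2) => k; rewrite geq_max => /andP[/hk1 /= fk /hk2 /= lk].
have : ((EFin \o G k) x <= \sum_(k <= i <oo) (EFin \o G i) x)%E.
  apply: le_trans (nneseries_lim_ge k.+1 (fun n _ _ => G0 n x)).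
  by rewrite big_nat1.
rewrite -(fineK fk) /= lee_fin => Gk.
have : G k x < g ^+ 2.
  by apply: (le_lt_trans Gk); move: lk; rewrite sub0r normrN; apply: le_lt_trans (ler_norm _).
by rewrite /G -[X in X < _]real_normK ?num_real // ltr_sqr ?nnegrE // ?(ltW g0) // => /ltW.
Qed.
End OrthogonalSums.
End BoundedIntegrals.

(* The Gram matrix of the canonical basis is invertible, so each coordinate is
   an inner product with a fixed vector. *)
Lemma coord_le_ipnorm (R : realType) (d : nat) (ip : 'rV[R]_d -> 'rV[R]_d -> R) :
  is_inner_product ip ->
  exists2 K, 0 <= K & forall (x : 'rV[R]_d) i, `|x ord0 i| <= K * ipnorm ip x.
Proof.
move=> ipP; pose b i : 'rV[R]_d := delta_mx ord0 i.
pose M : 'M[R]_d := \matrix_(i, j) ip (b i) (b j).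
have xM x j : (x *m M) ord0 j = ip x (b j).
  rewrite mxE {2}(row_sum_delta x).
  elim/big_rec2: _ => [|i u v _ ->]; first by rewrite ip0l.
  by rewrite ipDl // ipZl // mxE.
have uM : M \in unitmx.
  rewrite unitmxE unitfE; apply/negP => /det0P [v v0 vM].
  have : 0 < ip v v by case: ipP => _ _; apply.
  suff -> : ip v v = 0 by rewrite ltxx.
  rewrite {2}(row_sum_delta v); elim/big_rec: _ => [|i u _ hu].
    by rewrite ipC // ip0l.
  by rewrite ipDr // ipZr // hu addr0 -xM vM mxE mulr0.
pose K i := \sum_j ipnorm ip (b j) * `|invmx M j i|.
have K0 i : 0 <= K i by rewrite sumr_ge0 // => j _; rewrite mulr_ge0 // ipnorm_ge0.
exists (\sum_i K i) => [|x i]; first exact: sumr_ge0.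
apply: (@le_trans _ _ (K i * ipnorm ip x)); last first.
  by rewrite ler_wpM2r ?ipnorm_ge0 // (bigD1 i) //= lerDl sumr_ge0.
rewrite -{1}(mulmxK uM x) mxE mulr_suml; apply: (le_trans (ler_norm_sum _ _ _)).
apply: ler_sum => j _; rewrite normrM mulrAC ler_wpM2r // xM mulrC ler_norml.
apply/andP; split; last exact: ip_cauchy_schwarz.
rewrite lerNl -(ipnormN ipP x) -mulN1r -ipZl // scaleN1r.
exact: ip_cauchy_schwarz.
Qed.

(* [g] is the infimum over rational [q] of the functions [g q + K * |x - q|_1]. *)
Lemma lipschitz_measurable (R : realType) (d : nat) (d1 : measure_display)
    (U : measurableType d1) (W : U -> 'rV[R]_d) (g : 'rV[R]_d -> R) (K : R) :
  (forall i, measurable_fun setT (fun x => W x ord0 i)) -> 0 <= K ->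
  (forall x y, `|g x - g y| <= K * \sum_i `|x ord0 i - y ord0 i|) ->
  measurable_fun setT (fun x => g (W x)).
Proof.
move=> mW K0 gK; apply: (measurability _ (RGenInftyO.measurableE R)) => //.
move=> _ [_ [c ->] <-]; rewrite setTI.
pose q (r : 'rV[rat]_d) : 'rV[R]_d := map_mx ratr r.
have -> : (fun x => g (W x)) @^-1` `]-oo, c[%classic =
  \bigcup_(r in [set: 'rV[rat]_d])
    [set x | g (q r) + K * \sum_i `|W x ord0 i - q r ord0 i| < c].
  apply/seteqP; split => x /=; rewrite ?in_itv /=.
    (* The approximation error [e] is paid twice, in [g (q r)] and in the penalty, each time at most
       K d e; the added 1 makes the total strictly smaller than the gap. *)
    move=> lt; pose e := (c - g (W x)) / (2 * (K * d%:R + 1)).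
    have Kd : 0 <= K * d%:R by rewrite mulr_ge0.
    have e0 : 0 < e by rewrite divr_gt0 ?subr_gt0 // mulr_gt0 // ltr_wpDl.
    have ex i : exists r : rat, `|W x ord0 i - ratr r| <= e.
      have lte : W x ord0 i - e < W x ord0 i + e by lra.
      have [r] := rat_in_itvoo lte; rewrite in_itv /= => /andP[r1 r2].
      by exists r; rewrite ler_norml; apply/andP; split; lra.
    have [r hr] := choice ex.
    exists (\row_i r i) => //=.
    have hS : \sum_i `|W x ord0 i - q (\row_i r i) ord0 i| <= d%:R * e.
      have -> : d%:R * e = \sum_(i < d) e by rewrite sumr_const card_ord mulr_natl.
      by apply: ler_sum => i _; rewrite !mxE.
    have := gK (q (\row_i r i)) (W x).
    rewrite (eq_bigr (fun i => `|W x ord0 i - q (\row_i r i) ord0 i|)); last first.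
      by move=> i _; rewrite distrC.
    move=> h1; have h2 := ler_norm (g (q (\row_i r i)) - g (W x)).
    have h3 := ler_wpM2l K0 hS.
    have h4 : 2 * (K * (d%:R * e)) < c - g (W x).
      have -> : c - g (W x) = 2 * (K * d%:R + 1) * e.
        by rewrite /e; field; rewrite gt_eqF // ltr_wpDl.
      by move: e0; lra.
    by lra.
  move=> [r _ /=] /(le_lt_trans _) -> //.
  by have := gK (W x) (q r); have := ler_norm (g (W x) - g (q r)); lra.
apply: countable_bigcupT_measurable => [|r]; first exact: countableP.
have : measurable_fun setT (fun x => g (q r) + K * \sum_i `|W x ord0 i - q r ord0 i| < c).
  apply: measurable_fun_ltr; last exact: measurable_cst.
  apply: measurable_funD; first exact: measurable_cst.
  apply: measurable_funM; first exact: measurable_cst.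
  apply: measurable_sum => i; apply: measurableT_comp; first exact: normr_measurable.
  by apply: measurable_funB => //; exact: measurable_cst.
by move=> /(_ measurableT [set true] I); rewrite setTI.
Qed.

(** For [y] in [0, N] the sum counts the positive integers up to [y], so it is the integer part of
    [y]. *)
Lemma layer_sum (R : realType) (N : nat) (y : R) : 0 <= y <= N%:R ->
  0 <= y - \sum_(0 <= k < N) (k.+1%:R <= y)%R%:R <= 1.
Proof.
elim: N => [|N IH] /andP[y0 yN].
  by rewrite big_geq // subr0 y0 (le_trans yN).
rewrite big_nat_recr //=; have [le|lt] := leP y N%:R.
  rewrite [N.+1%:R <= y]lt_geF ?addr0; first by apply: IH; rewrite y0.
  by apply: le_lt_trans le _; rewrite ltr_nat.
have -> : \sum_(0 <= k < N) (k.+1%:R <= y)%R%:R = N%:R :> R.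
  rewrite big_nat (eq_bigr (fun=> 1)) => [|k /andP[_ kN]].
    by rewrite -big_nat sumr_const_nat subn0.
  by rewrite (le_trans _ (ltW lt)) // ler_nat.
move: yN; rewrite -natr1 => h2; have [h1|h1] := leP (N%:R + 1) y; rewrite /= ?mulr1n ?mulr0n; apply/andP; split; lra.
Qed.

(** * The martingale differences of the driving chain *)

Section ProcessMeasurability.
Variables (R : realType) (d : nat) (ip : 'rV[R]_d -> 'rV[R]_d -> R) (Y : finType).
Variables (H : 'rV[R]_d -> Y -> 'rV[R]_d) (Pk : 'rV[R]_d -> Y -> Y -> R) (CP L : R).
Hypothesis ipP : is_inner_product ip.
Local Notation N := (ipnorm ip).
Hypothesis CP0 : 0 <= CP.
Hypothesis L0 : 0 <= L.
Hypothesis PkL : forall w1 w2 y y',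
  `|Pk w1 y y' - Pk w2 y y'| <= CP / (1 + N w1 + N w2) * N (w1 - w2).
Hypothesis HL : forall w1 w2 y, N (H w1 y - H w2 y) <= L * N (w1 - w2).
Variables (d1 : measure_display) (U : measurableType d1) (a : nat -> R).
Variables (w : nat -> U -> 'rV[R]_d) (Yp : nat -> U -> Y) (t0 : nat).
Hypothesis wS : forall t om, w t.+1 om = w t om + a t *: H (w t om) (Yp t.+1 om).
Hypothesis mw0 : forall i, measurable_fun setT (fun om => w 0%N om ord0 i).
Hypothesis mY : forall t y, (t <= t0)%N -> measurable (Yp t @^-1` [set y]).

Lemma measurable_indicator t y : (t <= t0)%N ->
  measurable_fun setT (fun om => (Yp t om == y)%:R : R).
Proof.
move=> tt0; rewrite (_ : (fun om => _) = fun om => if Yp t om == y then 1 else 0); last first.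
  by apply/funext => om; case: eqP.
apply: measurable_fun_ifT; [|exact: measurable_cst..].
apply: (measurable_fun_bool true).
rewrite setTI; have := mY y tt0; congr measurable.
by apply/seteqP; split=> om /= /eqP.
Qed.

Lemma measurable_select t (F : Y -> U -> R) : (t <= t0)%N ->
  (forall y, measurable_fun setT (F y)) -> measurable_fun setT (fun om => F (Yp t om) om).
Proof.
move=> tt0 mF.
rewrite (_ : (fun om => _) = fun om => \sum_y (Yp t om == y)%:R * F y om); last first.
  by apply/funext => om; rewrite (sum_eq_indicator (F^~ om)).
apply: measurable_sum => y; apply: measurable_funM => //; exact: measurable_indicator.
Qed.

(** [U] is abstract and the states are measurable only up to [t0], so that the result serves both
    the ambient sigma-algebra and the one generated by [gen_class]. Coordinates of [H] are Lipschitz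
    for the coordinate sum by comparing norms in both directions. *)
Lemma measurable_iterate s i : (s <= t0)%N -> measurable_fun setT (fun om => w s om ord0 i).
Proof.
have [K K0 hK] := ipnorm_le_coord ipP; have [K' K'0 hK'] := coord_le_ipnorm ipP.
elim: s i => [|s IH] i st; first exact: mw0.
have {}IH j := IH j (ltnW st).
under eq_fun do rewrite wS mxE; apply: measurable_funD => //.
under eq_fun do rewrite mxE; apply: measurable_funM => //.
apply: (@measurable_select _ (fun y om => H (w s om) y ord0 i)) => // y.
apply: (@lipschitz_measurable _ _ _ _ (w s) (fun x => H x y ord0 i) (K' * (L * K))) => //.
  by rewrite !mulr_ge0.
move=> x x'; have := hK' (H x y - H x' y) i; rewrite !mxE => /le_trans; apply.
rewrite -mulrA ler_wpM2l //; apply: (le_trans (HL _ _ _)); rewrite -mulrA ler_wpM2l //.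
by apply: (le_trans (hK _)); rewrite ler_wpM2l // ler_sum // => j _; rewrite !mxE.
Qed.

(** The denominator in (P) is at least one, so each entry of the kernel is globally Lipschitz. *)
Lemma measurable_transition s z : (s <= t0)%N ->
  measurable_fun setT (fun om => Pk (w s om) (Yp s om) z).
Proof.
have [K K0 hK] := ipnorm_le_coord ipP.
move=> st; apply: (@measurable_select _ (fun y om => Pk (w s om) y z)) => // y.
apply: (@lipschitz_measurable _ _ _ _ (w s) (fun x => Pk x y z) (CP * K)) => //.
- by move=> i; exact: measurable_iterate.
- by rewrite !mulr_ge0.
move=> x x'; apply: (le_trans (PkL _ _ _ _)); rewrite -[leRHS]mulrA ler_pM ?ipnorm_ge0 //.
- by rewrite divr_ge0 // !addr_ge0 // ipnorm_ge0.
- rewrite ler_pdivrMr ?ler_peMr //; have := ipnorm_ge0 ip x; have := ipnorm_ge0 ip x'; lra.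
- apply: (le_trans (hK _)); rewrite ler_wpM2l // ler_sum // => j _; by rewrite !mxE.
Qed.

Lemma measurable_innovation s z : (s < t0)%N ->
  measurable_fun setT (fun om => (Yp s.+1 om == z)%:R - Pk (w s om) (Yp s om) z).
Proof.
move=> st; apply: measurable_funB; first exact: measurable_indicator.
exact: measurable_transition (ltnW st).
Qed.

End ProcessMeasurability.

(** * Events of the filtration and orthogonality of the innovations *)

Section Filtration.
Variables (d0 : measure_display) (T : measurableType d0) (R : realType) (Y : finType) (d : nat).
Variables (w0 : T -> 'rV[R]_d) (Yp : nat -> T -> Y) (t : nat).
Local Notation G := (gen_class w0 Yp t).
Local Notation U := (g_sigma_algebraType G).

(** A generator prescribes the whole path of states up to [t]; any condition [p] on that path is a
    finite union of such sets. *)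
Lemma gen_class_measurable (B : 'I_d -> set R) (p : {ffun 'I_t.+1 -> Y} -> Prop) :
  (forall i, measurable (B i)) ->
  measurable ([set om | (forall i, B i (w0 om ord0 i)) /\ p [ffun k : 'I_t.+1 => Yp k om]] : set U).
Proof.
move=> mB.
have -> : [set om | (forall i, B i (w0 om ord0 i)) /\ p [ffun k : 'I_t.+1 => Yp k om]] =
  \bigcup_(f in [set: {ffun 'I_t.+1 -> Y}]) [set om | p f /\
     ((forall i, B i (w0 om ord0 i)) /\ (forall k, (k <= t)%N -> Yp k om = f (inord k)))].
  apply/seteqP; split => om /=.
    move=> [Bom pom]; exists [ffun k : 'I_t.+1 => Yp k om] => //=; do 2 split => //.
    by move=> k kt; rewrite ffunE inordK.
  move=> [f _ /= [pf [Bom fE]]]; split => //; suff -> : [ffun k : 'I_t.+1 => Yp k om] = f by [].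
  by apply/ffunP => k; rewrite ffunE fE ?inord_val // -ltnS.
apply: countable_bigcupT_measurable => [|f]; first exact: countableP.
have [pf|npf] := pselect (p f); last first.
  by rewrite (_ : [set _ | _] = set0) //; apply/seteqP; split => om //= [].
apply: sub_sigma_algebra; exists B, (fun k => f (inord k)); split => //.
by apply/seteqP; split => om /= => [[]|].
Qed.

Lemma gen_class_measurable_state k y : (k <= t)%N ->
  measurable (Yp k @^-1` [set y] : set U).
Proof.
move=> kt; have := @gen_class_measurable (fun=> setT) (fun f => f (inord k) = y) (fun=> measurableT).
congr measurable; apply/seteqP; split => om /=; rewrite ffunE inordK ?ltnS //; by [case|split].
Qed.

Lemma gen_class_measurable_init i : measurable_fun (setT : set U) (fun om => w0 om ord0 i).
Proof.
move=> _ B mB; rewrite setTI.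
have := @gen_class_measurable (fun j => if j == i then B else setT) (fun=> True).
have h : forall j : 'I_d, measurable (if j == i then B else setT) by move=> j; case: ifP.
move=> /(_ h); congr measurable; apply/seteqP; split => om /=.
  by move=> [/(_ i)]; rewrite eqxx.
by move=> hB; split => // j; case: eqP => [->|].
Qed.

End Filtration.

Section Orthogonality.
Variables (R : realType) (d : nat) (ip : 'rV[R]_d -> 'rV[R]_d -> R) (Y : finType).
Variables (d0 : measure_display) (T : measurableType d0) (P : probability T R).
Variables (H : 'rV[R]_d -> Y -> 'rV[R]_d) (Pk : 'rV[R]_d -> Y -> Y -> R) (CP L : R).
Hypothesis ipP : is_inner_product ip.
Local Notation N := (ipnorm ip).
Hypothesis CP0 : 0 <= CP.
Hypothesis L0 : 0 <= L.
Hypothesis PkP : forall x, stochastic (Pk x).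
Hypothesis PkL : forall w1 w2 y y',
  `|Pk w1 y y' - Pk w2 y y'| <= CP / (1 + N w1 + N w2) * N (w1 - w2).
Hypothesis HL : forall w1 w2 y, N (H w1 y - H w2 y) <= L * N (w1 - w2).
Variables (a : nat -> R) (w : nat -> T -> 'rV[R]_d) (Yp : nat -> T -> Y).
Hypothesis wS : forall t om, w t.+1 om = w t om + a t *: H (w t om) (Yp t.+1 om).
Hypothesis mw0 : forall i, measurable_fun setT (fun om => w 0%N om ord0 i).
Hypothesis mY : forall t y, measurable (Yp t @^-1` [set y]).
Hypothesis markovP : forall t (A : set T) (y' : Y),
  <<s gen_class (w 0%N) Yp t >> A ->
  P (A `&` [set om | Yp t.+1 om = y']) =
  (\int[P]_(om in A) (Pk (w t om) (Yp t om) y')%:E)%E.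

Local Notation E f := (Rintegral P setT f).

Definition innovation z t om := (Yp t.+1 om == z)%:R - Pk (w t om) (Yp t om) z.

Lemma innovation_measurable z t : measurable_fun setT (innovation z t).
Proof.
exact: (measurable_innovation ipP CP0 L0 PkL HL wS mw0 (fun s y _ => mY s y) z (ltnSn t)).
Qed.

Lemma kernel01 x y z : 0 <= Pk x y z <= 1.
Proof.
have [P0 P1] := PkP x; rewrite P0 /=.
by apply: (@prob_vec_le1 _ _ (Pk x y)); split; [exact: P0|exact: P1].
Qed.

Lemma innovation_le1 z t om : `|innovation z t om| <= 1.
Proof.
have /andP[p0 p1] := kernel01 (w t om) (Yp t om) z.
by rewrite /innovation ler_norml; case: eqP => _; rewrite ?mulr1n ?mulr0n; apply/andP; split; lra.
Qed.

Lemma innovation_bounded z t : bounded_mfun (innovation z t).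
Proof. by split; [exact: innovation_measurable|exists 1; exact: innovation_le1]. Qed.

(** This is the Markov property on the event [A]: the indicator of [A] times the innovation is the
    indicator of the joint event minus the transition probability on [A]. *)
Lemma innovation_centered_on z t (A : set T) :
  <<s gen_class (w 0%N) Yp t >> A -> measurable A ->
  E (fun om => \1_A om * innovation z t om) = 0.
Proof.
move=> sA mA.
have b1 : bounded_mfun (\1_A : T -> R).
  split; first exact: measurable_indic.
  by exists 1 => x; rewrite indicE; case: (x \in A); rewrite ?normr1 ?normr0.
have bk : bounded_mfun (fun om => Pk (w t om) (Yp t om) z).
  split; first exact: (measurable_transition ipP CP0 L0 PkL HL wS mw0 (fun s y _ => mY s y) z (leqnn t)).
  by exists 1 => x; have /andP[p0 p1] := kernel01 (w t x) (Yp t x) z; rewrite ger0_norm.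
have mB : measurable (Yp t.+1 @^-1` [set z]) by exact: mY.
have bB : bounded_mfun (\1_(A `&` Yp t.+1 @^-1` [set z]) : T -> R).
  split; first by apply: measurable_indic; exact: measurableI.
  by exists 1 => x; rewrite indicE; case: (_ \in _); rewrite ?normr1 ?normr0.
have -> : (fun om => \1_A om * innovation z t om) =
  (fun om => \1_(A `&` Yp t.+1 @^-1` [set z]) om + (-1) * (\1_A om * Pk (w t om) (Yp t om) z)).
  apply/funext => om; rewrite /innovation indicI mulN1r mulrBr /=; congr (_ * _ - _).
  rewrite indicE; congr (_%:R); congr nat_of_bool.
  by apply/eqP/idP => [h|]; rewrite ?inE.
have bM := bounded_mfunM b1 bk.
rewrite expectD ?expectZ //; last exact: bounded_mfunZ.
rewrite mulN1r; apply/eqP; rewrite subr_eq0; apply/eqP; congr fine.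
rewrite integral_indic // ?setIT; last exact: measurableI.
apply: (etrans (markovP z sA)); rewrite [LHS]integral_mkcond; apply: eq_integral => om _.
by rewrite patchE indicE; case: ifP; rewrite /= ?mul1r ?mul0r.
Qed.

(* [f] is a uniform limit of averages of indicators of its superlevel sets. *)
Lemma innovation_centered z t (f : T -> R) :
  measurable_fun setT f ->
  measurable_fun (setT : set (g_sigma_algebraType (gen_class (w 0%N) Yp t))) f ->
  (forall om, 0 <= f om <= 1) -> E (fun om => f om * innovation z t om) = 0.
Proof.
move=> mf sf f01; apply: (@eq0_of_small _ 1) => e e0; rewrite mul1r.
pose n := (Num.truncn e^-1).+1; have n0 : 0 < n%:R :> R by rewrite ltr0n.
have ne : n%:R^-1 <= e.
  rewrite -[leRHS]invrK lef_pV2 ?posrE ?invr_gt0 //; exact/ltW/truncnS_gt.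
pose A k := [set om | k.+1%:R <= n%:R * f om].
have mA k : measurable (A k).
  have : measurable_fun setT (fun om => k.+1%:R <= n%:R * f om).
    by apply: measurable_fun_ler; [exact: measurable_cst|apply: measurable_funM => //; exact: measurable_cst].
  by move=> /(_ measurableT [set true] I); rewrite setTI.
have sA k : <<s gen_class (w 0%N) Yp t >> (A k).
  have : measurable_fun (setT : set (g_sigma_algebraType (gen_class (w 0%N) Yp t)))
      (fun om => k.+1%:R <= n%:R * f om).
    by apply: measurable_fun_ler; [exact: measurable_cst|apply: measurable_funM => //; exact: measurable_cst].
  by move=> /(_ measurableT [set true] I); rewrite setTI.
(* This is the integer part of n f divided by n, hence within 1/n of [f]. *)
pose g om : R := n%:R^-1 * \sum_(0 <= k < n) \1_(A k) om.
have fg om : `|f om - g om| <= n%:R^-1.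
  have /andP[f0 f1] := f01 om.
  have fn : 0 <= n%:R * f om <= n%:R by rewrite mulr_ge0 //= ler_piMr.
  have /andP[l u] := layer_sum fn.
  have -> : f om - g om = n%:R^-1 * (n%:R * f om - \sum_(0 <= k < n) (k.+1%:R <= n%:R * f om)%R%:R).
    rewrite mulrBr mulKf ?gt_eqF //; congr (_ - _ * _); apply: eq_bigr => k _.
    by rewrite indicE; congr (_%:R); congr nat_of_bool; apply/idP/idP; rewrite inE.
  by rewrite normrM (ger0_norm l) gtr0_norm ?invr_gt0 // ler_piMr // invr_ge0 ltW.
have b1 k : bounded_mfun (\1_(A k) : T -> R).
  split; first exact: measurable_indic.
  by exists 1 => x; rewrite indicE; case: (_ \in _); rewrite ?normr1 ?normr0.
have bg : bounded_mfun g by apply: bounded_mfunZ; exact: bounded_mfun_sum.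
have bf : bounded_mfun f.
  by split => //; exists 1 => x; have /andP[p0 p1] := f01 x; rewrite ger0_norm.
have bX := innovation_bounded z t.
have bgX : bounded_mfun (fun om => g om * innovation z t om) by exact: bounded_mfunM.
have bfg : bounded_mfun (fun om => f om - g om).
  by under eq_fun do rewrite -mulN1r; apply: bounded_mfunD => //; exact: bounded_mfunZ.
have Eg : E (fun om => g om * innovation z t om) = 0.
  have -> : (fun om => g om * innovation z t om) =
    (fun om => n%:R^-1 * \sum_(0 <= k < n) \1_(A k) om * innovation z t om).
    by apply/funext => om; rewrite /g -mulrA mulr_suml.
  rewrite expectZ; last by apply: bounded_mfun_sum => k; exact: bounded_mfunM.
  rewrite expect_sum; last by move=> k; exact: bounded_mfunM.
  by rewrite big1 ?mulr0 // => k _; exact: innovation_centered_on.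
have -> : E (fun om => f om * innovation z t om) =
    E (fun om => (f om - g om) * innovation z t om).
  rewrite -[RHS]addr0 -Eg -expectD //; last exact: bounded_mfunM.
  by congr (Rintegral P setT _); apply/funext => om; rewrite mulrBl subrK.
have bfX := bounded_mfunM bfg bX.
apply: (le_trans (le_normr_Rintegral measurableT (bounded_mfun_integrable P bfX))).
rewrite -[leRHS](expect_cst P); apply: expect_le; last first.
- move=> om; rewrite normrM -[leRHS]mulr1 ler_pM //; last exact: innovation_le1.
  exact: le_trans ne.
- exact: bounded_mfun_cst.
split; first exact: measurableT_comp bfX.1.
by have [_ [K bK]] := bfX; exists K => om; rewrite normr_id.
Qed.

(** As s < t, the earlier innovation is determined by the history up to [t]. It takes values in
    [-1, 1], so it is first mapped affinely into [0, 1], and the constant part is removed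
    afterwards. *)
Lemma innovation_orthogonal z s t : (s < t)%N ->
  E (fun om => innovation z s om * innovation z t om) = 0.
Proof.
move=> st; pose f om := 2^-1 * (innovation z s om + 1).
have bX r := innovation_bounded z r.
have fE : E (fun om => f om * innovation z t om) = 0.
  apply: innovation_centered.
  - apply: measurable_funM; first exact: measurable_cst.
    by apply: measurable_funD; [exact: innovation_measurable|exact: measurable_cst].
  - apply: measurable_funM; first exact: measurable_cst.
    apply: measurable_funD; last exact: measurable_cst.
    apply: (@measurable_innovation _ _ _ _ _ _ _ _ ipP CP0 L0 PkL HL _
      (g_sigma_algebraType (gen_class (w 0%N) Yp t)) _ _ _ t wS _ _ _ z st).
      by move=> i; exact: gen_class_measurable_init.
    by move=> k y kt; exact: gen_class_measurable_state.
  - by move=> om; have := innovation_le1 z s om; rewrite ler_norml /f => /andP[? ?]; apply/andP; split; lra.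
have E1 : E (fun om => 1 * innovation z t om) = 0.
  by apply: innovation_centered => [||om]; rewrite ?ler01 ?lexx //; exact: measurable_cst.
have -> : (fun om => innovation z s om * innovation z t om) =
  (fun om => 2 * (f om * innovation z t om) + (-1) * (1 * innovation z t om)).
  by apply/funext => om; rewrite /f; field.
have bf : bounded_mfun f.
  by apply: bounded_mfunZ; apply: bounded_mfunD => //; exact: bounded_mfun_cst.
have b1 := bounded_mfunM (bounded_mfun_cst T 1) (bX t).
have b2 := bounded_mfunM bf (bX t).
rewrite (expectD P (bounded_mfunZ 2 b2) (bounded_mfunZ (-1) b1)).
by rewrite expectZ // fE mulr0 add0r expectZ // E1 mulr0.
Qed.

End Orthogonality.

(** * Step sizes: divergence of the sum, convergence of the squares *)

Section StepSizes.
Variables (R : realType) (C nu : R).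
Hypothesis C0 : 0 < C.
Hypothesis nu_gt : 2 / 3 < nu.
Hypothesis nu_le1 : nu <= 1.

Definition step (t : nat) : R := C / ((t + 3)%:R `^ nu).

Let nu0 : 0 <= nu. Proof. by apply: le_trans (ltW nu_gt); rewrite divr_ge0. Qed.

Lemma step_gt0 t : 0 < step t.
Proof. by rewrite divr_gt0 // powR_gt0 // ltr0n addn_gt0 orbT. Qed.

Lemma step_nonincreasing t : step t.+1 <= step t.
Proof.
rewrite ler_pM2l // lef_pV2 ?posrE ?powR_gt0 ?ltr0n ?addn_gt0 ?orbT //.
by rewrite ge0_ler_powR ?nnegrE // ler_nat addSn.
Qed.

Lemma step_ge t : C / (t + 3)%:R <= step t.
Proof.
have t3 : 0 < (t + 3)%:R :> R by rewrite ltr0n addn_gt0 orbT.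
rewrite ler_pM2l // lef_pV2 ?posrE ?powR_gt0 //.
rewrite -[leRHS]powRr1 ?(ltW t3) // ler_powR //.
by rewrite ler1n addn_gt0 orbT.
Qed.

(** Harmonic doubling: the [m + 3] terms from [m] on are each at least C / (2(m + 3)), so they
    contribute at least [C / 2]. *)
Lemma step_diverges n K : exists m, K <= \sum_(n <= t < m) step t.
Proof.
suff h k : exists2 m, (n <= m)%N & k%:R * (C / 2) <= \sum_(n <= t < m) step t.
  have [m _ hm] := h (Num.truncn (K / (C / 2))).+1; exists m; apply: le_trans hm.
  by rewrite -ler_pdivrMr ?divr_gt0 // ltW // truncnS_gt.
elim: k => [|k [m nm IH]]; first by exists n => //; rewrite mul0r big_geq.
exists (m + (m + 3))%N; first by rewrite (leq_trans nm) // leq_addr.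
rewrite (big_cat_nat nm (leq_addr _ _)) /= -natr1 mulrDl mul1r lerD //.
have m3 : 0 < (m + 3)%:R :> R by rewrite ltr0n addn_gt0 orbT.
apply: (@le_trans _ _ (\sum_(m <= t < m + (m + 3)) C / (2 * (m + 3)%:R))).
  rewrite sumr_const_nat addKn -[leRHS]mulr_natr.
  by rewrite invfM mulrA mulrVK ?unitfE ?gt_eqF.
apply: ler_sum_nat => t /andP[mt tm]; apply: le_trans (step_ge t).
rewrite ler_pM2l // lef_pV2 ?posrE ?mulr_gt0 // ?ltr0n ?addn_gt0 ?orbT //.
by rewrite -natrM ler_nat; lia.
Qed.

(* With b^3 = c^3 + 1, the difference 1/c - 1/b = 1/(b c (b^2 + b c + c^2)) dominates 1/(3 b^4). *)
Lemma step_sqr_sum n : \sum_(0 <= t < n) step t ^+ 2 <= 3 * C ^+ 2.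
Proof.
pose c (t : nat) : R := (t + 2)%:R `^ (1 / 3).
have c0 t : 0 < c t by rewrite powR_gt0 // ltr0n addn_gt0 orbT.
have c3 t : c t ^+ 3 = (t + 2)%:R.
  by rewrite /c -powR_mulrn ?powR_ge0 // -powRrM mul1r mulVf // powRr1.
have sq t : step t ^+ 2 <= C ^+ 2 * (3 * ((c t)^-1 - (c t.+1)^-1)).
  rewrite /step expr_div_n ler_pM2l ?exprn_gt0 //.
  (* The bound [nu > 2/3] enters here: the squared step decays at least like (t + 3)^(-4/3), which
     is the fourth inverse power of [c t.+1]. *)
  have h1 : c t.+1 ^+ 4 <= ((t + 3)%:R `^ nu) ^+ 2.
    rewrite /c addSnnS -!powR_mulrn ?powR_ge0 // -!powRrM ler_powR //.
      by rewrite ler1n addn_gt0 orbT.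
    rewrite (_ : 1 / 3 * 4 = 2 / 3 * 2); last by field.
    by rewrite ler_pM2r // ltW.
  apply: (@le_trans _ _ (c t.+1 ^+ 4)^-1).
    by rewrite lef_pV2 ?posrE ?exprn_gt0 ?powR_gt0 // ltr0n addn_gt0 orbT.
  have E : c t.+1 ^+ 3 = c t ^+ 3 + 1 by rewrite !c3 addSn -natr1.
  move: (c0 t) (c0 t.+1) E; set x := c t; set y := c t.+1 => x0 y0 E.
  have xy : x < y.
    by rewrite -(@ltr_pXn2r _ 3) ?nnegrE ?(ltW x0) ?(ltW y0) // E ltrDl.
  have -> : 3 * (x^-1 - y^-1) = 3 * (y - x) / (x * y).
    by field; rewrite !gt_eqF.
  rewrite ler_pdivlMr ?mulr_gt0 // mulrC ler_pdivrMr ?exprn_gt0 //.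
  have h2 : 1 <= 3 * (y - x) * y ^+ 2.
    have F : 1 = (y - x) * (y ^+ 2 + y * x + x ^+ 2).
      by rewrite (_ : (y - x) * _ = y ^+ 3 - x ^+ 3); [rewrite E addrAC subrr add0r | ring].
    rewrite [leLHS]F (mulrC 3) -mulrA ler_pM2l ?subr_gt0 //.
    have : y * x <= y * y by rewrite ler_pM2l // ltW.
    have : x * x <= y * y by rewrite ler_pM // ltW.
    by lra.
  have h3 : y * y <= y * y * (3 * (y - x) * y ^+ 2) by rewrite ler_peMr // mulr_ge0 // ltW.
  have h4 : x * y <= y * y by rewrite ler_pM2r // ltW.
  by lra.
apply: (@le_trans _ _ (\sum_(0 <= t < n) C ^+ 2 * (3 * ((c t)^-1 - (c t.+1)^-1)))).
  by apply: ler_sum => t _.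
rewrite -mulr_sumr -mulr_sumr mulrC -mulrA ler_pM2l // ler_piMl ?sqr_ge0 //.
have -> : \sum_(0 <= t < n) ((c t)^-1 - (c t.+1)^-1) = (c 0%N)^-1 - (c n)^-1.
  have := telescope_sumr (fun t => - (c t)^-1) (leq0n n).
  by rewrite opprK addrC => <-; apply: eq_bigr => t _; rewrite opprK addrC.
apply: (@le_trans _ _ (c 0%N)^-1); first by rewrite gerBl invr_ge0 ltW.
rewrite invf_le1 // -(powRr0 (0 + 2)%:R) /c ler_powR ?ler1n //.
Qed.

(** Steps all larger than [e] would make the sums of squares unbounded. *)
Lemma step_small e : 0 < e -> exists n, step n <= e.
Proof.
move=> e0; apply: contrapT => h.
have gt t : e < step t by rewrite ltNge; apply/negP => le; apply: h; exists t.
pose n := (Num.truncn (3 * C ^+ 2 / e ^+ 2)).+1.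
have := step_sqr_sum n; apply/negP; rewrite -ltNge.
apply: (@lt_le_trans _ _ (n%:R * e ^+ 2)).
  by rewrite -ltr_pdivrMr ?exprn_gt0 // truncnS_gt.
have -> : n%:R * e ^+ 2 = \sum_(0 <= t < n) e ^+ 2 by rewrite sumr_const_nat subn0 mulr_natl.
by apply: ler_sum => t _; rewrite ler_sqr ?nnegrE ?(ltW e0) // ltW // step_gt0.
Qed.

End StepSizes.

(** * Almost sure boundedness by a deterministic radius, and the rates *)

Theorem theorem6
  (R : realType) (d : nat) (ip : 'rV[R]_d -> 'rV[R]_d -> R)
  (Y : finType)
  (d0 : measure_display) (T : measurableType d0) (P : probability T R)
  (H : 'rV[R]_d -> Y -> 'rV[R]_d)
  (Pk : 'rV[R]_d -> Y -> Y -> R)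
  (C_alpha nu C_P L_h C1 C2 : R)
  (w : nat -> T -> 'rV[R]_d) (Yp : nat -> T -> Y) :
  is_inner_product ip ->
  (* (LR1) *)
  0 < C_alpha -> 2 / 3 < nu -> nu <= 1 ->
  (* the iteration w_{t+1} = w_t + alpha_t H(w_t, Y_{t+1}) *)
  (forall t om, w t.+1 om =
     w t om + (C_alpha / ((t + 3)%:R `^ nu)) *: H (w t om) (Yp t.+1 om)) ->
  (* w_0 and the Y_t are random variables *)
  (forall i, measurable_fun setT (fun om => w 0%N om ord0 i)) ->
  (forall t (y : Y), measurable (Yp t @^-1` [set y])) ->
  (* (M): Markov property w.r.t. F_t = sigma(w_0, Y_0, ..., Y_t) *)
  (forall w', stochastic (Pk w')) ->
  (forall t (A : set T) (y' : Y),
     <<s gen_class (w 0%N) Yp t >> A ->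
     P (A `&` [set om | Yp t.+1 om = y']) =
     (\int[P]_(om in A) (Pk (w t om) (Yp t om) y')%:E)%E) ->
  (forall Q, in_closure_family Pk Q -> irreducible Q /\ aperiodic Q) ->
  (* (P) with the entrywise max matrix norm *)
  (forall w1 w2 y y',
     `|Pk w1 y y' - Pk w2 y y'| <=
       C_P / (1 + ipnorm ip w1 + ipnorm ip w2) * ipnorm ip (w1 - w2)) ->
  (* (L) *)
  (forall w1 w2 y, ipnorm ip (H w1 y - H w2 y) <= L_h * ipnorm ip (w1 - w2)) ->
  (forall y, ipnorm ip (H 0 y) <= L_h) ->
  (* (D): h(w) = sum_y d_{Y,w}(y) H(w,y), d_{Y,w} the (unique) stationary law of P_w *)
  0 < C1 ->
  (forall w' mu, stationary (Pk w') mu ->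
     ip w' (hbar H mu w') <= - C1 * ipnorm ip w' ^+ 2 + C2) ->
  exists R0 : R, 0 <= R0 /\
    (nu < 1 -> forall zeta : R, 0 < zeta -> zeta < 3 / 2 * nu - 1 ->
       {ae P, forall om,
          (fun t : nat => t%:R `^ zeta * dist_ball ip R0 (w t om)) @ \oo --> 0}) /\
    (nu = 1 -> forall zeta nu1 : R, 0 < zeta -> zeta < 1 -> 0 < nu1 ->
       {ae P, forall om,
          (fun t : nat => expR (zeta * (ln t%:R) `^ (1 / (1 + nu1)))
                            * dist_ball ip R0 (w t om)) @ \oo --> 0}).
Proof.
move=> ipP Ca0 nu_gt nu_le1 wS mw0 mY PkP markovP PkI PkL HL HB0 C10 HD.
(* The sample space is pointed, so evaluating the process shows that there is a state. *)
have y0 : Y := Yp 0%N point.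
(* [C_P] may be negative and [L_h] may be zero; the enlarged constants have the signs required
   above. *)
pose CP := `|C_P|; pose L := L_h + 1.
have Lh0 : 0 <= L_h by exact: le_trans (ipnorm_ge0 ip _) (HB0 y0).
have L0 : 0 < L by rewrite ltr_wpDl.
have PkL' w1 w2 y y' : `|Pk w1 y y' - Pk w2 y y'| <=
    CP / (1 + ipnorm ip w1 + ipnorm ip w2) * ipnorm ip (w1 - w2).
  apply: (le_trans (PkL _ _ _ _)); rewrite ler_wpM2r ?ipnorm_ge0 // ler_wpM2r ?ler_norm //.
  by rewrite invr_ge0 !addr_ge0 // ipnorm_ge0.
have HL' w1 w2 y : ipnorm ip (H w1 y - H w2 y) <= L * ipnorm ip (w1 - w2).
  by apply: (le_trans (HL _ _ _)); rewrite ler_wpM2r ?ipnorm_ge0 // lerDl.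
have HB x y : ipnorm ip (H x y) <= L * (1 + ipnorm ip x).
  rewrite -(subrK (H 0 y) (H x y)); apply: (le_trans (ipnorm_triangle ipP _ _)).
  rewrite mulrDr mulr1 addrC lerD //; first by rewrite (le_trans (HB0 y)) // lerDl.
  by rewrite -{2}[x]subr0.
have PkI' Q : in_closure_family Pk Q -> irreducible Q by move=> /PkI [].
pose a := step C_alpha nu.
have a0 t : 0 <= a t by rewrite ltW // step_gt0.
have adec t : a t.+1 <= a t by exact: step_nonincreasing.
have wS' t om : w t.+1 om = w t om + a t *: H (w t om) (Yp t.+1 om) by exact: wS.
have [delta [g [dl0 g0 bound]]] :=
  eventually_bounded_of_small_noise y0 ipP (normr_ge0 C_P) L0 C10 PkP PkI' PkL' HL' HB HD.
have [nb nbP] := block_partition dl0 g0 a0 adec (step_small Ca0 nu_gt)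
  (step_diverges Ca0 nu_gt nu_le1).
have nbS k : (nb k < nb k.+1)%N by have [] := nbP k.
have small z := block_sums_small
  (innovation_measurable ipP (normr_ge0 C_P) (ltW L0) PkL' HL' wS' mw0 mY z)
  (innovation_le1 PkP w Yp z)
  (fun s t => innovation_orthogonal ipP (normr_ge0 C_P) (ltW L0) PkP PkL' HL' wS' mw0 mY markovP z (s := s) (t := t))
  nbS (step_sqr_sum Ca0 nu_gt) g0.
pose R0 := 2 * Num.sqrt ((2 * `|C2| + C1) / C1 + 1) + 1.
have ev : {ae P, forall om, exists t0, forall t, (t0 <= t)%N -> ipnorm ip (w t om) <= R0}.
  apply: (filterS _ (filter_forall _ small)) => om sm.
  apply: (bound a nb (w ^~ om) (Yp ^~ om) a0 adec nbP).
    by move=> t; exact: wS'.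
  (* The starting block depends on the state [z]; finiteness of [Y] allows the maximum. *)
  have [k0 hk0] := choice sm; exists (\max_z k0 z) => k kk z.
  by apply: hk0; apply: leq_trans kk; exact: leq_bigmax.
have lim (c : nat -> R) :
    {ae P, forall om, (fun t => c t * dist_ball ip R0 (w t om)) @ \oo --> 0}.
  apply: (filterS _ ev) => om [t0 ht0].
  have c0 : \forall t \near \oo, c t * dist_ball ip R0 (w t om) = 0.
    exists t0 => // t /= /ht0 h.
    by rewrite /dist_ball max_r ?mulr0 // subr_le0.
  exact: cvg_near_cst c0.
exists R0; split; first by rewrite addr_ge0 // mulr_ge0 // sqrtr_ge0.
by split=> _ *; exact: lim.
Qed.
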